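(* Let $\mathcal{H}$ be a real Hilbert space with inner product $\langle\cdot,\cdot\rangle$ and norm $\|\cdot\|$. Let $\Phi:\mathcal{H}\to\mathbb{R}$ be a convex $C^1$ function such that $\arg\min\Phi=\{v\in\mathcal{H}:\Phi(v)=\Phi^*\}$ is nonempty, where $\Phi^*=\min_{x\in\mathcal{H}}\Phi(x)$. Let $c>0$, $\alpha\in[0,1)$, $\gamma(t)=\frac{c}{(1+t)^\alpha}$, and $g\in L^1(0,+\infty;\mathcal{H})$. Let $x\in W^{2,1}_{loc}(0,+\infty;\mathcal{H})$ be a solution of $$\ddot x(t)+\gamma(t)\dot x(t)+\nabla\Phi(x(t))=g(t),\quad t\ge 0,$$ and let $W(t)=\frac12\|\dot x(t)\|^2+\Phi(x(t))-\Phi^*$. Assume that $\int_0^{+\infty}(1+t)^\alpha\|g(t)\|\,dt<\infty$. Then $x(t)$ converges weakly in $\mathcal{H}$ as $t\to+\infty$ to some $x^*\in\arg\min\Phi$. Moreover, $W(t)=O\left(\frac{1}{t^{2\alpha}}\right)$ as $t\to+\infty$ and $\int_0^{+\infty}(1+t)^\alpha W(t)\,dt<\infty$.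
   Context: $W^{2,1}_{loc}(0,+\infty;\mathcal{H})$ denotes functions whose first and second (weak) derivatives are locally integrable with values in $\mathcal{H}$; $\dot x,\ddot x$ denote the first and second time derivatives. *)

(* Defs.v *)
From HB Require Import structures.
From mathcomp Require Import all_boot all_order all_algebra.
From mathcomp Require Import all_classical all_reals all_analysis.
Set Implicit Arguments. Unset Strict Implicit. Unset Printing Implicit Defensive.
Import Order.TTheory GRing.Theory Num.Theory.
Import numFieldNormedType.Exports.
Local Open Scope classical_set_scope.
Local Open Scope ring_scope.

(* [ip] is an inner product on the normed space [V] whose norm is the
   norm induced by [ip] (so a complete such [V] is a real Hilbert space). *)
Definition is_inner_product (R : realType) (V : normedModType R)
    (ip : V -> V -> R) : Prop :=
  [/\ (forall x y, ip x y = ip y x),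
      (forall x y z, ip (x + y) z = ip x z + ip y z),
      (forall (a : R) x y, ip (a *: x) y = a * ip x y)
    & (forall x, `|x| = Num.sqrt (ip x x))].

Definition convex_fun (R : realType) (V : normedModType R) (f : V -> R) : Prop :=
  forall (x y : V) (l : R), 0 <= l <= 1 ->
    f ((1 - l) *: x + l *: y) <= (1 - l) * f x + l * f y.

Definition is_gradient (R : realType) (V : normedModType R)
    (ip : V -> V -> R) (f : V -> R) (G : V -> V) : Prop :=
  forall x (e : R), 0 < e -> exists2 d : R, 0 < d &
    forall h : V, `|h| < d -> `|f (x + h) - f x - ip (G x) h| <= e * `|h|.

Definition abs_continuous_on (R : realType) (V : normedModType R)
    (a b : R) (f : R -> V) : Prop :=
  forall e : R, 0 < e -> exists2 d : R, 0 < d &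
    forall (n : nat) (u v : 'I_n -> R),
      (forall i, a <= u i /\ u i <= v i /\ v i <= b) ->
      (forall i j, i != j -> v i <= u j \/ v j <= u i) ->
      \sum_(i < n) (v i - u i) < d ->
      \sum_(i < n) `|f (v i) - f (u i)| < e.

Definition strongly_measurable (R : realType) (V : normedModType R)
    (D : set R) (g : R -> V) : Prop :=
  exists (k : nat -> nat) (A : nat -> nat -> set (measurableTypeR R))
         (c : nat -> nat -> V),
    (forall n i, measurable (A n i)) /\
    (forall t, D t ->
       (fun n => \sum_(i < k n) ((\1_(A n i) t : R) *: c n i)) @ \oo --> g t).

Definition L1_pos (R : realType) (V : normedModType R) (g : R -> V) : Prop :=
  strongly_measurable `[0%R, +oo[%classic g /\
  (\int[@lebesgue_measure R]_(t in `[0%R, +oo[%classic) (`|g t|)%:E < +oo)%E.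

(* Main.v *)
Require Import Defs.
From HB Require Import structures.
From mathcomp Require Import all_boot all_order all_algebra.
From mathcomp Require Import all_classical all_reals all_analysis.
From mathcomp Require Import measurable_realfun ring lra.
Import Order.TTheory GRing.Theory Num.Theory.
Import numFieldNormedType.Exports.
Local Open Scope classical_set_scope.
Local Open Scope ring_scope.
Set Implicit Arguments.
Unset Strict Implicit.
Unset Printing Implicit Defensive.

(** Write [lam t = (1 + t)^alpha], let [z] be a minimizer and [W] the energy.
    Since the damping is [c / lam], the function
      [F = K lam^2 W + lam <x', x - z> + (c - lam') |x - z|^2 / 2]
    with [K = 8 / c] satisfies, by the gradient inequality for [Phi],
      [F' <= - lam W / 2 - lam'' |x - z|^2 / 2 + lam |g| (|x - z| + K lam |x'|)]
    once [lam'] is small, and it dominates both [lam^2 W] and [|x - z|^2].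
    A Gronwall argument, applied to [ln (1 + F) + K lam' / 2], bounds [F], whence
    [W = O(lam^-2)] and the integrability of [lam W]. Then [lam^2 W] has a limit,
    which vanishes because [1 / lam] is not integrable, so that [|x - z|]
    converges. Weak convergence follows as in Opial's lemma; weak compactness is
    replaced by the existence of a common point of the closed convex sets that
    eventually contain the trajectory (their points of almost minimal norm form
    a Cauchy filter). *)

(** * Absolutely continuous functions *)

Section AbsolutelyContinuous.
Context {R : realType}.
Implicit Types (a b s t e : R).
Notation mu := (@lebesgue_measure R).

(** The equation holds only almost everywhere and [x'] is merely absolutely continuous, so no
    differential inequality can be integrated by the mean value theorem. Each is integrated by a
    monotonicity lemma for absolutely continuous real functions whose derivative is nonpositive
    almost everywhere. The forcing enters only through the real function [lam |g|], so no
    vector-valued integral appears. The coefficient [c - lam'] in [F] comes from the cross term: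
    differentiating [lam <x', x - z>] leaves [(lam' - c) <x', x - z>], which the derivative of
    [(c - lam') |x - z|^2 / 2] cancels. The price is [- lam'' |x - z|^2 / 2], of the wrong sign
    since [lam] is concave; but [- lam''] has a bounded integral because [lam'] is bounded. Adding a
    multiple of [lam'] therefore absorbs this error, inside the logarithm estimate and again once
    [F] is bounded. The weight is used only through [1 <= lam <= 1 + t], [0 <= lam' <= 1],
    [-1 <= lam'' <= 0] and [lam' --> 0]. *)

Lemma is_derive1_epsP (V : normedModType R) (f : R -> V) t (d : V) :
  is_derive t (1 : R) f d <->
  forall e, 0 < e -> exists2 r : R, 0 < r &
    forall s, `|s - t| < r -> `|f s - f t - (s - t) *: d| <= e * `|s - t|.
Proof.
have E (h : R) : h != 0 ->
    `|d - h^-1 *: (f (h *: 1 + t) - f t)| =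
    `|h|^-1 * `|f (h + t) - f t - h *: d|.
  move=> h0; rewrite distrC -normfV -normrZ [in RHS]scalerBr scalerA mulVf// scale1r.
  by rewrite /GRing.scale/= mulr1.
split=> [[df Df] e e0|H].
  move: df => /cvg_ex[l dl]; have ld : l = d by rewrite -Df; apply/esym/cvg_lim.
  move: dl; rewrite ld => /cvgrPdist_le/(_ _ e0)/= -[r/= r0 Hr].
  exists r => // s sr; have [->|st] := eqVneq s t.
    by rewrite !subrr scale0r subr0 !normr0 mulr0.
  have s0 : s - t != 0 by rewrite subr_eq0.
  have := Hr (s - t); rewrite /ball_/= sub0r normrN => /(_ sr s0).
  rewrite E// subrK ler_pdivrMl ?normr_gt0//.
  by rewrite [X in _ <= X]mulrC.
have dl : h^-1 *: ((f \o shift t) (h *: (1 : R)) - f t) @[h --> 0^'] --> d.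
  apply/cvgrPdist_le => e e0; have [r r0 Hr] := H e e0.
  exists r => //= h /=; rewrite sub0r normrN => hr h0.
  rewrite E// ler_pdivrMl ?normr_gt0//.
  have := Hr (h + t); rewrite addrK => /(_ hr) /le_trans; apply.
  by rewrite mulrC.
split; first by apply/cvg_ex; exists d.
by apply/cvg_lim.
Qed.

(* [t] is good when [f t - f a] is at most [e (t - a)] plus the variation of [f]
   over finitely many disjoint intervals of total length at most
   [mu (U `&` `]a, t])], where [U] is an open set of measure < [dl] covering the
   exceptional null set. Goodness extends across every point, through [U] or
   through a nonpositive derivative, so the supremum of the good points is [b]. *)
Lemma abs_continuous_le0_derive_nincr (f : R -> R) a b : a <= b ->
  abs_continuous_on a b f ->
  {ae mu, forall t, a <= t <= b -> exists2 d, is_derive t (1 : R) f d & d <= 0} ->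
  f b <= f a.
Proof.
move=> ab acf [N [mN N0 subN]].
suff H e : 0 < e -> f b - f a <= e * (b - a) + e.
  rewrite -subr_le0; apply/ler_addgt0Pl => e e0; rewrite addr0.
  have k0 : 0 < b - a + 1 by rewrite ltr_wpDl ?subr_ge0.
  apply: le_trans (H (e / (b - a + 1)) _) _; first by rewrite divr_gt0.
  by rewrite -[X in _ + X]mulr1 -mulrDr divfK ?gt_eqF.
move=> e0; have [dl dl0 Hdl] := acf e e0.
have [U [oU NU]] : exists U : set R, [/\ open U, N `<=` U & (mu U < dl%:E)%E].
  have Noo : (mu N < +oo)%E by rewrite N0.
  have [U [oU NU]] := lebesgue_regularity_outer mN Noo dl0.
  move=> UN; exists U; split=> //; apply: le_lt_trans UN.
  have mU : measurable U by exact: open_measurable.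
  rewrite -[in leLHS](setDUK NU) measureU//; last 2 first.
  - exact: measurableD.
  - by rewrite setIDA setIC -setIDA setDv setI0.
  change (mu N + mu (U `\` N) <= mu (U `\` N))%E.
  by rewrite N0 add0e.
have mU : measurable U by exact: open_measurable.
move=> Udl.
pose good t := exists n (u v : nat -> R), [/\
  (forall i, (i < n)%N -> [/\ a <= u i, u i <= v i & v i <= t]),
  (forall i j, (i < j < n)%N -> v i <= u j),
  ((\sum_(i < n) (v i - u i))%:E <= mu (U `&` `]a, t]))%E &
  f t - f a <= e * (t - a) + \sum_(i < n) `|f (v i) - f (u i)| ].
have gooda : good a.
  exists 0%N, (fun=> 0), (fun=> 0); split=> //.
  - by rewrite big_ord0 measure_ge0.
  - by rewrite big_ord0 !subrr mulr0 addr0.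
have good_mon s t : a <= s -> s <= t -> good s ->
    (f t - f s <= e * (t - s) \/ [set` `]s, t]] `<=` U) -> good t.
  move=> as_ st [n [u [v [uv vu muU fs]]]] [fst|stU].
    exists n, u, v; split=> //.
    - by move=> i /uv[? ? vs]; split=> //; exact: le_trans st.
    - apply: (le_trans muU); apply: le_measure; rewrite ?inE.
      + exact: measurableI.
      + exact: measurableI.
      + by apply: setIS; apply: subset_itvl; rewrite bnd_simp.
    - lra.
  exists n.+1, (fun i => if (i < n)%N then u i else s),
    (fun i => if (i < n)%N then v i else t); split.
  - move=> i; rewrite ltnS; case: ltnP => [/uv[? ? vs] _|_ _]; split=> //; exact: le_trans st.
  - move=> i j /andP[ij]; rewrite ltnS => jn.
    have iN := leq_trans ij jn; rewrite iN; case: ltnP => jn'.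
      by apply: vu; rewrite ij.
    by have [] := uv _ iN.
  - rewrite big_ord_recr/= ltnn (eq_bigr (fun i : 'I_n => v i - u i)); last first.
      by move=> i _; rewrite ltn_ord.
    rewrite EFinD.
    have -> : U `&` `]a, t] = (U `&` `]a, s]) `|` [set` `]s, t]].
      rewrite (@itv_bndbnd_setU _ _ (BRight a) (BRight s)) ?bnd_simp// setIUr.
      by congr (_ `|` _); apply/seteqP; split=> [r []//|r /[dup] /stU].
    rewrite measureU//=.
    + by rewrite leeD// lebesgue_measure_itv/= lte_fin; case: ltP => // ?;
        rewrite lee_fin subr_le0.
    + exact: measurableI.
    + rewrite -setIA; apply/seteqP; split=> // r/= [_].
      rewrite !in_itv/= => -[/andP[_ rs] /andP[sr _]].
      by move: (lt_le_trans sr rs); rewrite ltxx.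
  - rewrite big_ord_recr/= ltnn.
    rewrite (eq_bigr (fun i : 'I_n => `|f (v i) - f (u i)|)); last first.
      by move=> i _; rewrite ltn_ord.
    have := ler_norm (f t - f s).
    have : 0 <= e * (t - s) by rewrite mulr_ge0 ?subr_ge0// ltW.
    lra.
pose S := [set t | a <= t <= b /\ good t].
have supS : has_sup S.
  split; first by exists a; split=> //; rewrite lexx.
  by exists b => t [/andP[]].
have [ac cb] : a <= sup S /\ sup S <= b.
  split; first by apply: ub_le_sup; [exact: supS.2|split=> //; rewrite lexx].
  by apply: ge_sup; [exact: supS.1|move=> t [/andP[]]].
set c := sup S in ac cb.
have [r r0 Hr] : exists2 r : R, 0 < r & forall s t, a <= s -> t <= b ->
    c - r < s -> s <= c -> c <= t -> t < c + r -> good s -> good t.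
  have [Uc|nUc] := pselect (U c).
    have /nbhs_ballP[r/= r0 rU] : nbhs c U by exact: open_nbhs_nbhs.
    exists r => // s t as_ tb crs sc ct tcr gs.
    apply: (good_mon s) => //; first exact: le_trans ct.
    right=> q /=; rewrite in_itv/= => /andP[sq qt]; apply: rU.
    rewrite /ball/= ltr_norml; apply/andP; split; lra.
  have [d df d0] : exists2 d, is_derive c (1 : R) f d & d <= 0.
    apply: contrapT => nd; apply/nUc/NU/subN => /= H; apply/nd/H.
    by rewrite ac.
  have [r r0 Hr] := (is_derive1_epsP _ _ _).1 df e e0.
  exists r => // s t as_ tb crs sc ct tcr gs.
  apply: (good_mon s) => //; first exact: le_trans ct.
  left; have st := le_trans sc ct.
  have := Hr s; rewrite ler0_norm ?subr_le0// => /(_ ltac:(lra)).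
  rewrite ler_norml => /andP[H1 _].
  have := Hr t; rewrite ger0_norm ?subr_ge0// => /(_ ltac:(lra)).
  rewrite ler_norml => /andP[_ H2].
  rewrite /GRing.scale/= in H1 H2.
  have h1 : (t - c) * d <= 0 by rewrite mulr_ge0_le0 ?subr_ge0.
  have h2 : 0 <= (s - c) * d by rewrite mulr_le0 ?subr_le0.
  lra.
have [s [/andP[as_ sb] gs] cs] := sup_adherent r0 supS.
have sc : s <= c by apply: ub_le_sup; [exact: supS.2|split=> //; rewrite as_].
have gb : good b.
  have [bcr|crb] := ltP b (c + r); first by apply: (Hr s b).
  have c2 : c <= c + r / 2 by rewrite lerDl divr_ge0 ?ltW.
  have gt : good (c + r / 2).
    apply: (Hr s) => //; last by rewrite ltrD2l ltr_pdivrMr// ltr_pMr// ltr1n.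
    by apply: le_trans crb; rewrite lerD2l ler_pdivrMr// ler_peMr ?ler1n// ltW.
  have : c + r / 2 <= c.
    apply: ub_le_sup; first exact: supS.2.
    split=> //; rewrite (le_trans ac)//=.
    by apply: le_trans crb; rewrite lerD2l ler_pdivrMr// ler_peMr ?ler1n// ltW.
  by rewrite gerDl leNgt divr_gt0.
have [n [u [v [uv vu muU fb]]]] := gb.
apply: (le_trans fb); rewrite lerD2l ltW//.
apply: (Hdl n (fun i => u i) (fun i => v i)).
- by move=> i; have [] := uv i (ltn_ord i).
- move=> i j; rewrite -val_eqE neq_ltn => /orP[ij|ij].
    by left; apply: vu; rewrite ij/=.
  by right; apply: vu; rewrite ij/=.
rewrite -lte_fin; apply: le_lt_trans Udl; apply: (le_trans muU).
apply: le_measure; rewrite ?inE//; exact: measurableI.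
Qed.

End AbsolutelyContinuous.

Section AC2.
Context {R : realType}.
Implicit Types (a b s t e : R).
Notation mu := (@lebesgue_measure R).

(** Two reference functions are allowed because the velocity is to be paired with time, and later a
    function so controlled with the primitive of the forcing. *)
Lemma abs_continuous_dom (V1 V2 V : normedModType R) (y : R -> V1)
    (z : R -> V2) (f : R -> V) a b (L : R) :
  abs_continuous_on a b y -> abs_continuous_on a b z ->
  (forall u v, a <= u -> u <= v -> v <= b ->
    `|f v - f u| <= L * (`|y v - y u| + `|z v - z u|)) ->
  abs_continuous_on a b f.
Proof.
move=> acy acz fL e e0.
have L0 : 0 < `|L| + 1 by rewrite ltr_wpDl.
have e20 : 0 < e / (`|L| + 1) / 2 by rewrite !divr_gt0.
have [d1 d10 H1] := acy _ e20; have [d2 d20 H2] := acz _ e20.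
exists (Num.min d1 d2); first by rewrite lt_min d10.
move=> n u v uv vu; rewrite lt_min => /andP[/(H1 _ _ _ uv vu) h1 /(H2 _ _ _ uv vu) h2].
apply: (@le_lt_trans _ _ ((`|L| + 1) *
   (\sum_(i < n) `|y (v i) - y (u i)| + \sum_(i < n) `|z (v i) - z (u i)|))).
  rewrite -big_split/= mulr_sumr; apply: ler_sum => i _.
  have [? [? ?]] := uv i.
  apply: le_trans (fL _ _ _ _ _) _ => //; rewrite ler_wpM2r ?addr_ge0//.
  by rewrite (le_trans (ler_norm L))// lerDl.
by rewrite mulrC -ltr_pdivlMr//; lra.
Qed.

Lemma abs_continuous_id a b : abs_continuous_on a b (fun t : R => t).
Proof.
move=> e e0; exists e => // n u v uv _ H; apply: le_lt_trans H.
apply: ler_sum => i _; have [_ [? _]] := uv i.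
by rewrite ger0_norm ?subr_ge0.
Qed.

(** Half-open intervals stay disjoint when the families of [abs_continuous_on] share endpoints, and
    a degenerate one is empty. *)
Lemma sum_measure_disjoint_itv n (u v : 'I_n -> R) :
  (forall i, u i <= v i) ->
  (forall i j, i != j -> v i <= u j \/ v j <= u i) ->
  trivIset setT (fun i => [set` `]u i, v i]]) /\
  mu (\big[setU/set0]_(i < n) [set` `]u i, v i]]) = (\sum_(i < n) (v i - u i))%:E.
Proof.
move=> uv vu.
have tr : trivIset setT (fun i => [set` `]u i, v i]]).
  move=> i j _ _ [r/= []]; rewrite !in_itv/= => /andP[ur rv] /andP[ur' rv'].
  have [//|/vu[H|H]] := eqVneq i j.
    by move: (lt_le_trans (le_lt_trans H ur') rv); rewrite ltxx.
  by move: (lt_le_trans (le_lt_trans H ur) rv'); rewrite ltxx.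
split=> //; rewrite measure_semi_additive_ord//=.
  rewrite -sumEFin; apply: eq_bigr => i _.
  rewrite lebesgue_measure_itv/= lte_fin; case: ltP => // vui.
  have -> : v i = u i by apply/eqP; rewrite eq_le vui uv.
  by rewrite subrr.
by apply: bigsetU_measurable => i _; exact: measurable_itv.
Qed.

(** * Primitives of nonnegative integrable functions *)

Section primitive.
Variable h : R -> R.
Hypothesis h0 : forall t, 0 <= h t.
Hypothesis ih : mu.-integrable setT (EFin \o h).

Let ihA (A : set R) : measurable A -> mu.-integrable A (EFin \o h).
Proof. by move=> mA; apply: integrableS ih. Qed.

Definition primitive t := (\int[mu]_(s in `]-oo, t]) h s)%R.

Lemma primitiveB s t : s <= t ->
  primitive t - primitive s = (\int[mu]_(r in `]s, t]) h r)%R.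
Proof. by move=> st; rewrite /primitive Rintegral_itvB//; exact: ihA. Qed.

Lemma primitive_nondecreasing s t : s <= t -> primitive s <= primitive t.
Proof. by move=> st; rewrite -subr_ge0 primitiveB// Rintegral_ge0. Qed.

Lemma primitive_bounded t : 0 <= primitive t <= (\int[mu]_s h s)%R.
Proof.
rewrite Rintegral_ge0//= /primitive Rintegral_mkcond.
apply: le_Rintegral => //.
  rewrite -restrict_EFin; apply/integrable_restrict => //=.
  by rewrite setTI; exact: ihA.
by move=> s _; rewrite patchE; case: ifP.
Qed.

(** The sum of the increments is the integral of [h] over a disjoint union of intervals, which is
    small with the measure of that union. *)
Lemma abs_continuous_primitive a b : abs_continuous_on a b primitive.
Proof.
move=> e e0; have [d [d0 Hd]] := integral_normr_continuous ih e0.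
exists d => // n u v uv vu Hs.
have uv' i : u i <= v i by have [_ []] := uv i.
have [tr muE] := sum_measure_disjoint_itv uv' vu.
have mD : measurable (\big[setU/set0]_(i < n) [set` `]u i, v i]]).
  by apply: bigsetU_measurable => i _; exact: measurable_itv.
have muD : (mu (\big[setU/set0]_(i < n) [set` `]u i, v i]]) < d%:E)%E.
  by rewrite muE lte_fin.
apply: le_lt_trans (Hd _ mD muD).
under eq_bigr do rewrite primitiveB// ger0_norm ?Rintegral_ge0//.
rewrite [leRHS](_ : _ = (\int[mu]_(x in \big[setU/set0]_(i < n) [set` `]u i, v i]]) h x)%R); last first.
  by apply: eq_Rintegral => t _; rewrite ger0_norm.
rewrite -lee_fin /Rintegral fineK; last exact: integrable_fin_num (ihA mD).
rewrite integral_bigsetU_EFin//.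
- rewrite -sumEFin; apply: lee_sum => i _; rewrite fineK//.
  by apply: integrable_fin_num => //; exact: ihA.
- exact: index_enum_uniq.
- by apply: sub_trivIset tr.
- by have /integrableP[] := ihA mD.
Qed.

Lemma primitive_derive_ae : {ae mu, forall t, is_derive t (1 : R) primitive (h t)}.
Proof.
have ihy y : mu.-integrable `]-oo, y] (EFin \o h) by exact: ihA.
have := FTC1Ny ihy (open_integrable_locally openT ih).
apply: filterS; first exact: (ae_filter_ringOfSetsType mu).
by move=> t [dt <-]; rewrite derive1E; exact: derivableP.
Qed.

End primitive.
End AC2.

(** * Inner products and Opial's lemma *)

Section InnerProduct.
Context {R : realType} {H : completeNormedModType R}.
Variable ip : H -> H -> R.
Hypothesis hip : is_inner_product ip.
Implicit Types (u v w p q : H).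

Lemma ipC u v : ip u v = ip v u. Proof. by case: hip. Qed.
Lemma ipDl u v w : ip (u + v) w = ip u w + ip v w. Proof. by case: hip. Qed.
Lemma ipZl (k : R) u v : ip (k *: u) v = k * ip u v. Proof. by case: hip. Qed.
Lemma ipDr u v w : ip u (v + w) = ip u v + ip u w.
Proof. by rewrite ipC ipDl !(ipC u). Qed.
Lemma ipZr (k : R) u v : ip u (k *: v) = k * ip u v.
Proof. by rewrite ipC ipZl ipC. Qed.
Lemma ipNl u v : ip (- u) v = - ip u v.
Proof. by rewrite -scaleN1r ipZl mulN1r. Qed.
Lemma ipNr u v : ip u (- v) = - ip u v.
Proof. by rewrite ipC ipNl ipC. Qed.
Lemma ipBl u v w : ip (u - v) w = ip u w - ip v w.
Proof. by rewrite ipDl ipNl. Qed.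
Lemma ipBr u v w : ip u (v - w) = ip u v - ip u w.
Proof. by rewrite ipDr ipNr. Qed.
Lemma ip0l u : ip 0 u = 0.
Proof. by rewrite -(scale0r u) ipZl mul0r. Qed.

Lemma normip_sqr u : `|u| ^+ 2 = ip u u.
Proof.
have nE : `|u| = Num.sqrt (ip u u) by case: hip.
(* A negative [ip u u] would have square root 0 by convention, whence [u = 0] and [ip u u = 0], a
   contradiction. *)
rewrite nE; have [u0|u0] := leP 0 (ip u u); first by rewrite sqr_sqrtr.
move: nE; rewrite ler0_sqrtr ?ltW// => /normr0_eq0 uE.
by move: u0; rewrite uE ip0l ltxx.
Qed.

Lemma ip_ge0 u : 0 <= ip u u. Proof. by rewrite -normip_sqr sqr_ge0. Qed.

Lemma ip_CauchySchwarz u v : `|ip u v| <= `|u| * `|v|.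
Proof.
have [->|v0] := eqVneq v 0.
  by rewrite ipC ip0l !normr0 mulr0.
have vv : 0 < ip v v by rewrite -normip_sqr exprn_gt0// normr_gt0.
rewrite -(ler_pXn2r (ltn0Sn 1)) ?nnegrE ?mulr_ge0//.
rewrite exprMn !normip_sqr real_normK ?num_real//.
(* The vector is [ip v v] times the component of [u] orthogonal to [v]; this scaling avoids a
   division. *)
have E : ip (ip v v *: u - ip u v *: v) (ip v v *: u - ip u v *: v) =
    ip v v * (ip u u * ip v v - ip u v ^+ 2).
  by rewrite ipBl !ipBr !ipZl !ipZr (ipC v u); ring.
have := ip_ge0 (ip v v *: u - ip u v *: v); rewrite E.
by rewrite pmulr_rge0// subr_ge0.
Qed.

Lemma ip_le u v : ip u v <= `|u| * `|v|.
Proof. exact: le_trans (ler_norm _) (ip_CauchySchwarz u v). Qed.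

Lemma cvg_ip (T : Type) (F : set_system T) {FF : Filter F} (f g : T -> H) p q :
  f @ F --> p -> g @ F --> q -> ip (f t) (g t) @[t --> F] --> ip p q.
Proof.
move=> fp gq.
have lim0 : `|f t - p| * `|g t| + `|p| * `|g t - q| @[t --> F] --> (0 : R).
  rewrite -[X in _ --> X](_ : `|p - p| * `|q| + `|p| * `|q - q| = 0 :> R); last first.
    by rewrite !subrr !normr0 mul0r mulr0 addr0.
  apply: cvgD; apply: cvgM.
  - by apply: cvg_norm; apply: cvgB => //; exact: cvg_cst.
  - exact: cvg_norm.
  - exact: cvg_cst.
  - by apply: cvg_norm; apply: cvgB => //; exact: cvg_cst.
apply/cvgrPdist_le => e e0 /=; move/cvgrPdist_le : lim0 => /(_ e e0).
apply: filterS => t /=; rewrite sub0r normrN ger0_norm; last first.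
  by rewrite addr_ge0// mulr_ge0.
apply: le_trans.
rewrite distrC (_ : _ - _ = ip (f t - p) (g t) + ip p (g t - q)); last first.
  by rewrite ipBl ipBr; ring.
by apply: le_trans (ler_normD _ _) _; rewrite lerD ?ip_CauchySchwarz.
Qed.

Lemma is_derive1_cvgP (V : normedModType R) (f : R -> V) (t : R) (d : V) :
  is_derive t (1 : R) f d <-> h^-1 *: (f (h + t) - f t) @[h --> 0^'] --> d.
Proof.
have E : (fun h : R => h^-1 *: (f (h + t) - f t)) =
         (fun h : R => h^-1 *: ((f \o shift t) (h *: (1 : R)) - f t)).
  by apply/funext => h; rewrite /= /GRing.scale/= mulr1.
rewrite E; split=> [[df Df]|H1].
  by rewrite -Df; move: df => /cvg_ex[l dl]; rewrite /derive (cvg_lim _ dl).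
by split; [apply/cvg_ex; exists d|apply/cvg_lim].
Qed.

Lemma is_derive1_continuous (V : normedModType R) (f : R -> V) (t : R) (d : V) :
  is_derive t (1 : R) f d -> {for t, continuous f}.
Proof.
by move=> [df _]; apply/differentiable_continuous/derivable1_diffP.
Qed.

Lemma is_derive_ip (f g : R -> H) (t : R) (df dg : H) :
  is_derive t (1 : R) f df -> is_derive t (1 : R) g dg ->
  is_derive t (1 : R) (fun s => ip (f s) (g s)) (ip df (g t) + ip (f t) dg).
Proof.
move=> Df Dg; apply/is_derive1_cvgP.
rewrite (_ : (fun h : R => _) = (fun h : R => ip (h^-1 *: (f (h + t) - f t)) (g (h + t)) +
    ip (f t) (h^-1 *: (g (h + t) - g t)))); last first.
  by apply/funext => h; rewrite /GRing.scale/= ipZl ipZr ipBl ipBr; ring.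
apply: cvgD; apply: cvg_ip.
- exact/is_derive1_cvgP.
- have gt := is_derive1_continuous Dg.
  have : h + t @[h --> (0 : R)^'] --> t.
    rewrite -[X in _ --> X]add0r; apply: cvgD; last exact: cvg_cst.
    exact: cvg_within.
  by move=> /cvg_comp; apply.
- exact: cvg_cst.
- exact/is_derive1_cvgP.
Qed.

Definition convex_set (K : set H) : Prop :=
  forall u v (l : R), 0 <= l <= 1 -> K u -> K v -> K ((1 - l) *: u + l *: v).

Lemma closed_halfspace v (r : R) : closed [set u | ip u v <= r].
Proof.
apply: (@closed_comp _ _ (fun u => ip u v) [set s | s <= r]); last exact: closed_le.
by move=> u _; apply: cvg_ip; [exact: cvg_id|exact: cvg_cst].
Qed.

Lemma convex_halfspace v (r : R) : convex_set [set u | ip u v <= r].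
Proof.
move=> a b l /andP[l0 l1] /= ar br; rewrite ipDl !ipZl.
have : (1 - l) * ip a v <= (1 - l) * r by rewrite ler_wpM2l ?subr_ge0.
have : l * ip b v <= l * r by rewrite ler_wpM2l.
lra.
Qed.

(** * A substitute for weak cluster points, and Opial's lemma *)

Section asymptotic.
Variable x : R -> H.
Variables (T0 M : R).
Hypothesis xM : forall t, T0 <= t -> `|x t| <= M.

Definition unbounded (A : set R) := forall T : R, exists2 t, T <= t & A t.

Definition eventually_in (A : set R) (K : set H) :=
  exists T : R, forall t, T <= t -> A t -> K (x t).

(** These points form the intersection of the closed convex hulls of the tails of [x] along [A],
    where [A] plays the role of a subsequence. This may be larger than the set of weak cluster
    points, but only half-spaces and sublevel sets of [Phi] will be tested, and both are closed and
    convex. *)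
Definition asymptotic_point (A : set R) p := forall K, closed K ->
  convex_set K -> eventually_in A K -> K p.

Lemma asymptotic_point_exists A : unbounded A -> exists p, asymptotic_point A p.
Proof.
move=> unA.
pose Fam K := [/\ closed K, convex_set K & eventually_in A K].
have FamI K L : Fam K -> Fam L -> Fam (K `&` L).
  move=> [cK vK [T KT]] [cL vL [U LU]]; split; first exact: closedI.
    by move=> u v l l01 [? ?] [? ?]; split; [apply: vK|apply: vL].
  exists (Num.max T U) => t; rewrite ge_max => /andP[Tt Ut] At.
  by split; [apply: KT|apply: LU].
(* The distance from the origin to [K]. It grows as [K] shrinks and stays below [M] on the family,
   so its supremum [d] is finite and almost attained. *)
pose m (K : set H) : R := inf [set `|u| | u in K].
have mlb (K : set H) : has_lbound ([set `|u| | u in K] : set R).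
  by exists 0; move=> _ [u _ <-]; exact: normr_ge0.
have FamM K : Fam K -> exists2 u, K u & `|u| <= M.
  move=> [_ _ [T KT]]; have [t] := unA (Num.max T T0).
  rewrite ge_max => /andP[Tt T0t] At; exists (x t); [exact: KT|exact: xM].
have FamT : Fam setT by split; [exact: closedT|by []|exists 0].
pose D := [set m K | K in Fam].
have mK0 K : Fam K -> 0 <= m K.
  move=> /FamM[u Ku _]; apply: lb_le_inf; first by exists `|u|, u.
  by move=> _ [w _ <-]; exact: normr_ge0.
have mM K : Fam K -> m K <= M.
  move=> /FamM[u Ku uM]; apply: le_trans uM.
  by apply: ge_inf => //; exists u.
have supD : has_sup D.
  by split; [exists (m setT), setT|exists M => _ [K /mM ? <-]].
set d := sup D.
have md K : Fam K -> m K <= d by move=> FK; apply: ub_le_sup; [exact: supD.2|exists K].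
have d0 : 0 <= d by apply: le_trans (mK0 _ FamT) (md _ FamT).
pose B (i : set H * R) := [set u | i.1 u /\ `|u| <= d + i.2].
pose I := [set i : set H * R | Fam i.1 /\ 0 < i.2].
pose G := filter_from I B.
have PG : ProperFilter G.
  apply: filter_from_proper; last first.
    move=> [K e] [/= FK e0]; have [v Kv _] := FamM _ FK.
    have [_ [u Ku <-] ue] : exists2 r, [set `|u| | u in K] r & r < inf [set `|u| | u in K] + e.
      by apply: inf_adherent => //; split=> //; exists `|v|, v.
    exists u; split=> //=; apply: ltW; apply: lt_le_trans ue _.
    by rewrite lerD2r md.
  apply: filter_from_filter.
    by exists (setT, 1); split=> /=.
  move=> [K e] [L e'] [/= FK e0] [/= FL e0'].
  exists (K `&` L, Num.min e e'); first by split=> /=; [exact: FamI|rewrite lt_min e0].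
  move=> u [/= [Ku Lu]] ue; split; split=> //=; apply: le_trans ue _;
    by rewrite lerD2l ge_min lexx ?orbT.
have cG : cauchy G.
  apply: cauchy_exP.
  move=> e e0.
  have k0 : 0 < 8 * (2 * d + 1) by rewrite mulr_gt0// ltr_wpDl// mulr_ge0.
  (* Choose [K] with [m K > d - h]. If [u] and [v] in [K] have norm at most [d + h], their midpoint
     is in [K], so the parallelogram law gives [|v - u|^2 <= 4 ((d + h)^2 - (m K)^2) <= 8 h (2 d +
     1)]. The last division by 2 makes the final bound strict. *)
  pose h := Num.min 1 (e ^+ 2 / (8 * (2 * d + 1)) / 2).
  have h0 : 0 < h by rewrite lt_min ltr01 !divr_gt0// exprn_gt0.
  have [_ [K FK <-] mKd] := sup_adherent h0 supD.
  have [v [Kv vh]] : B (K, h) !=set0.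
    by apply: (@filter_ex _ G); exists (K, h) => //; split.
  exists v, (K, h); first by split.
  move=> u [/= Ku uh].
  rewrite -ball_normE /ball_/= -(ltr_pXn2r (ltn0Sn 1)) ?nnegrE//; last exact: ltW.
  have mid : m K <= `|2^-1 *: (u + v)|.
    apply: ge_inf => //; exists (2^-1 *: (u + v)) => //.
    rewrite scalerDr; have -> : 2^-1 *: u = (1 - 2^-1) *: u :> H.
      by congr (_ *: _); field.
    by case: FK => _ cK _; apply: cK => //; rewrite invr_ge0 ler0n/= invf_le1 ?ler1n.
  have mid2 : (m K) ^+ 2 <= 4^-1 * `|u + v| ^+ 2.
    have -> : 4^-1 * `|u + v| ^+ 2 = `|2^-1 *: (u + v)| ^+ 2.
      by rewrite normrZ exprMn ger0_norm ?invr_ge0//; congr (_ * _); field.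
    by rewrite ler_pXn2r ?nnegrE ?mK0.
  have par : `|v - u| ^+ 2 + `|u + v| ^+ 2 = 2 * `|u| ^+ 2 + 2 * `|v| ^+ 2.
    by rewrite !normip_sqr ipBl !ipBr ipDl !ipDr (ipC v u); ring.
  have u2 : `|u| ^+ 2 <= (d + h) ^+ 2 by rewrite ler_pXn2r ?nnegrE// addr_ge0// ltW.
  have v2 : `|v| ^+ 2 <= (d + h) ^+ 2 by rewrite ler_pXn2r ?nnegrE// addr_ge0// ltW.
  have h1 : h <= 1 by rewrite ge_min lexx.
  have he : h * (8 * (2 * d + 1)) < e ^+ 2.
    rewrite -ltr_pdivlMr//; have : h <= e ^+ 2 / (8 * (2 * d + 1)) / 2.
      by rewrite ge_min lexx orbT.
    have : 0 < e ^+ 2 / (8 * (2 * d + 1)) by rewrite divr_gt0// exprn_gt0.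
    lra.
  have mKd2 : d - h < m K := mKd.
  have mKd' := md _ FK; have mK0' := mK0 _ FK.
  have : (d + h - m K) * (d + h + m K) <= (2 * h) * (2 * d + 1).
    apply: ler_pM; lra.
  rewrite -subr_sqr; lra.
have /cvg_ex[p Gp] : cvg G by apply: cauchy_cvg.
exists p => K clK cvK evK.
apply: (@closed_cvg _ _ G _ id K clK _ p); last exact: Gp.
by exists (K, 1); [split=> //=|move=> u []].
Qed.

Lemma asymptotic_point_halfspace A p v (r : R) : asymptotic_point A p ->
  eventually_in A [set u | ip u v <= r] -> ip p v <= r.
Proof.
move=> ap ev; apply: (ap [set u | ip u v <= r]) => //.
- exact: closed_halfspace.
- exact: convex_halfspace.
Qed.

(** If weak convergence to [p] failed in a direction [y], the bad times would have an asymptotic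
    point [q] separated from [p] by [y]. Expanding the squares, convergence of [|x - p|^2] and
    [|x - q|^2] makes [<x, p - q>] converge to some [l]; half-spaces then force
    [<p, p - q> = l = <q, p - q>], so [p = q]. *)
Lemma Opial (S : set H) :
  (forall z, S z -> exists l : R, `|x t - z| ^+ 2 @[t --> +oo] --> l) ->
  (forall A p, unbounded A -> asymptotic_point A p -> S p) ->
  exists p, S p /\ forall y, ip (x t) y @[t --> +oo] --> ip p y.
Proof.
move=> cvS asS.
have unT : unbounded setT by move=> T; exists T.
have [p ap] := asymptotic_point_exists unT.
exists p; split; first exact: asS ap.
suff bdd y (e : R) : 0 < e -> exists T, forall t, T <= t -> ip (x t) y < ip p y + e.
  move=> y; apply/cvgrPdist_le => e e0.
  have [T HT] := bdd y e e0; have [T' HT'] := bdd (- y) e e0.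
  near=> t.
  have tT : T <= t by near: t; exact/nbhs_pinfty_ge/num_real.
  have tT' : T' <= t by near: t; exact/nbhs_pinfty_ge/num_real.
  have := HT t tT; have := HT' t tT'; rewrite !ipNr => h1 h2.
  rewrite ler_norml; apply/andP; split; lra.
move=> e0; apply: contrapT => nT.
pose A := [set t | ip p y + e <= ip (x t) y].
have unA : unbounded A.
  move=> T; apply: contrapT => nA; apply: nT; exists T => t Tt.
  by rewrite ltNge; apply/negP => At; apply: nA; exists t.
have [q aq] := asymptotic_point_exists unA.
have qy : ip q (- y) <= - (ip p y + e).
  apply: (asymptotic_point_halfspace aq).
  by exists 0 => t _ At /=; rewrite ipNr lerN2.
have [lp xp] := cvS p (asS _ _ unT ap); have [lq xq] := cvS q (asS _ _ unA aq).
pose l := (lq - lp + `|p| ^+ 2 - `|q| ^+ 2) / 2.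
have xl : ip (x t) (p - q) @[t --> +oo] --> l.
  rewrite (_ : (fun t : R => _) = (fun t : R => (`|x t - q| ^+ 2 - `|x t - p| ^+ 2 +
      `|p| ^+ 2 - `|q| ^+ 2) / 2)).
    apply: cvgM; last exact: cvg_cst.
    apply: cvgB; last exact: cvg_cst.
    apply: cvgD; last exact: cvg_cst.
    exact: cvgB.
  apply/funext => t; rewrite !normip_sqr !ipBl !ipBr (ipC p) (ipC q).
  by field.
have lE B r : unbounded B -> asymptotic_point B r -> ip r (p - q) = l.
  move=> unB ar; apply/eqP; rewrite eq_le; apply/andP; split.
    apply/ler_addgt0Pr => k k0.
    apply: (asymptotic_point_halfspace ar).
    move/cvgrPdist_le : xl => /(_ k k0)[T [_ HT]].
    exists (T + 1) => t Tt _ /=; have := HT t; rewrite /= => /(_ ltac:(lra)).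
    rewrite ler_norml => /andP[? ?]; lra.
  apply/ler_addgt0Pr => k k0.
  suff : ip r (- (p - q)) <= - l + k by rewrite ipNr; lra.
  apply: (asymptotic_point_halfspace ar).
  move/cvgrPdist_le : xl => /(_ k k0)[T [_ HT]].
  exists (T + 1) => t Tt _ /=; have := HT t; rewrite /= => /(_ ltac:(lra)).
  rewrite ipNr ler_norml => /andP[? ?]; lra.
have : `|p - q| ^+ 2 = 0.
  by rewrite normip_sqr ipBl (lE _ _ unT ap) (lE _ _ unA aq) subrr.
move/eqP; rewrite sqrf_eq0 normr_eq0 subr_eq0 => /eqP pq.
move: qy; rewrite -pq ipNr; lra.
Unshelve. all: by end_near.
Qed.

End asymptotic.

End InnerProduct.

(** * The potential *)

Section Potential.
Context {R : realType} {H : completeNormedModType R}.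
Variables (ip : H -> H -> R) (Phi : H -> R) (G : H -> H).
Hypothesis hip : is_inner_product ip.
Hypothesis hconv : convex_fun Phi.
Hypothesis hgrad : is_gradient ip Phi G.

(** Convexity along the segment from [u] to [z], divided by a step [l] small enough for the
    first-order expansion of [Phi] at [u] to apply. *)
Lemma gradient_inequality u z : ip (G u) (z - u) <= Phi z - Phi u.
Proof.
apply/ler_addgt0Pr => e e0.
have k0 : 0 < `|z - u| + 1 by rewrite ltr_wpDl.
have [d d0 Hd] := hgrad u (divr_gt0 e0 k0).
pose l := Num.min 1 (d / (`|z - u| + 1) / 2).
have l0 : 0 < l by rewrite lt_min ltr01 !divr_gt0.
have l1 : l <= 1 by rewrite ge_min lexx.
have lz : `|l *: (z - u)| <= l * (`|z - u| + 1).
  by rewrite normrZ gtr0_norm// ler_pM2l// lerDl.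
have ld : `|l *: (z - u)| < d.
  apply: le_lt_trans lz _; rewrite -ltr_pdivlMr//.
  have : l <= d / (`|z - u| + 1) / 2 by rewrite ge_min lexx orbT.
  have : 0 < d / (`|z - u| + 1) by rewrite divr_gt0.
  lra.
have := Hd _ ld; rewrite (ipZr hip) ler_norml => /andP[+ _] => h1.
have h2 : e / (`|z - u| + 1) * `|l *: (z - u)| <= e * l.
  rewrite mulrAC ler_pdivrMr// -mulrA; apply: ler_wpM2l => //; exact: ltW.
have l01 : 0 <= l <= 1 by rewrite ltW.
have := hconv u z l01.
have -> : (1 - l) *: u + l *: z = u + l *: (z - u).
  by rewrite scalerBl scale1r scalerBr addrA addrAC.
move=> h3; rewrite -(ler_pM2l l0); lra.
Qed.

Lemma gradient_continuous : continuous Phi.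
Proof.
move=> u; apply/cvgrPdist_le => e e0.
have [d d0 Hd] := hgrad u ltr01.
pose k := `|G u| + 1; have k0 : 0 < k by rewrite ltr_wpDl.
near=> v.
have vu : `|v - u| < d.
  by rewrite distrC; near: v; apply: cvgr_dist_lt => //; exact: cvg_id.
have vu2 : `|v - u| <= e / k.
  rewrite distrC; near: v; apply: cvgr_dist_le; first exact: cvg_id.
  exact: divr_gt0.
have := Hd _ vu; rewrite (addrC u) subrK mul1r => h1.
rewrite distrC -[_ - _](subrK (ip (G u) (v - u))).
apply: le_trans (ler_normD _ _) _.
have h2 := ip_CauchySchwarz hip (G u) (v - u).
apply: (@le_trans _ _ (k * `|v - u|)); first by rewrite /k; lra.
by rewrite mulrC -ler_pdivlMr.
Unshelve. all: by end_near. Qed.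

Lemma is_derive_gradient (f : R -> H) (t : R) (df : H) :
  is_derive t (1 : R) f df ->
  is_derive t (1 : R) (fun s => Phi (f s)) (ip (G (f t)) df).
Proof.
move=> Df; apply/is_derive1_epsP => e e0.
pose g := `|G (f t)| + 1; have g0 : 0 < g by rewrite ltr_wpDl.
pose k := `|df| + 1; have k0 : 0 < k by rewrite ltr_wpDl.
have [d d0 Hd] := hgrad (f t) (divr_gt0 (divr_gt0 e0 (ltr0n R 2)) k0).
(* The error is the remainder of [Phi] plus the gradient paired with the remainder of [f]; each is
   allotted [e / 2]. The bound [e2 <= 1] makes [k] a local Lipschitz constant of [f] at [t]. *)
pose e2 := Num.min 1 (e / 2 / g).
have e20 : 0 < e2 by rewrite lt_min ltr01 !divr_gt0.
have [r r0 Hr] := (is_derive1_epsP _ _ _).1 Df e2 e20.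
exists (Num.min r (d / k)); first by rewrite lt_min r0 divr_gt0.
move=> s; rewrite lt_min => /andP[sr sd].
have h1 := Hr s sr.
have e21 : e2 <= 1 by rewrite ge_min lexx.
have e2g : e2 * g <= e / 2 by rewrite -ler_pdivlMr// ge_min lexx orbT.
have h2 : `|f s - f t| <= k * `|s - t|.
  rewrite -[f s - f t](subrK ((s - t) *: df)).
  apply: le_trans (ler_normD _ _) _; rewrite normrZ.
  have : e2 * `|s - t| <= `|s - t| by rewrite ler_piMl.
  rewrite /k; lra.
have h3 : `|f s - f t| < d.
  by apply: le_lt_trans h2 _; rewrite mulrC -ltr_pdivlMr.
have := Hd _ h3; rewrite (addrC (f t)) subrK => h4.
rewrite (_ : _ - _ = (Phi (f s) - Phi (f t) - ip (G (f t)) (f s - f t)) +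
    ip (G (f t)) (f s - f t - (s - t) *: df)); last first.
  by rewrite (ipBr hip _ (f s - f t)) (ipZr hip) /GRing.scale/=; ring.
apply: le_trans (ler_normD _ _) _.
have h5 := ip_CauchySchwarz hip (G (f t)) (f s - f t - (s - t) *: df).
have h6 : e / 2 / k * `|f s - f t| <= e / 2 * `|s - t|.
  rewrite mulrAC ler_pdivrMr// -[leRHS]mulrA; apply: ler_wpM2l.
    by rewrite divr_ge0// ltW.
  by rewrite mulrC.
have h7 : `|G (f t)| * `|f s - f t - (s - t) *: df| <= g * (e2 * `|s - t|).
  by apply: ler_pM => //; rewrite lerDl.
have h8 : g * (e2 * `|s - t|) <= e / 2 * `|s - t|.
  by rewrite mulrA (mulrC g); apply: ler_wpM2r.
lra.
Qed.

(** Stands in for weak lower semicontinuity: sublevel sets of [Phi] are closed and convex. *)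
Lemma asymptotic_point_sublevel (x : R -> H) (A : set R) p (m : R) :
  (forall e, 0 < e -> exists T, forall t, T <= t -> Phi (x t) <= m + e) ->
  asymptotic_point x A p -> Phi p <= m.
Proof.
move=> xm ap; apply/ler_addgt0Pr => e e0.
apply: (ap [set u | Phi u <= m + e]).
- apply: (@closed_comp _ _ Phi [set s | s <= m + e]); last exact: closed_le.
  by move=> u _; exact: gradient_continuous.
- move=> u v l /[dup] l01 /andP[l0 l1] /= um vm.
  apply: le_trans (hconv u v l01) _.
  have : (1 - l) * Phi u <= (1 - l) * (m + e) by rewrite ler_wpM2l ?subr_ge0.
  have : l * Phi v <= l * (m + e) by rewrite ler_wpM2l.
  lra.
- by have [T HT] := xm e e0; exists T => t Tt _; exact: HT.
Qed.

End Potential.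

(** * Measurability of the norm of a strongly measurable function *)

Section StronglyMeasurable.
Context {R : realType} (V : normedModType R).

(** The offset [v] carries the induction: on [A n] the last value is absorbed into it, elsewhere
    that value disappears. *)
Lemma measurable_norm_simple n (A : nat -> set (measurableTypeR R)) (c : nat -> V)
    (D : set (measurableTypeR R)) (v : V) :
  (forall i, measurable (A i)) -> measurable D ->
  measurable_fun D (fun t => `|v + \sum_(i < n) ((\1_(A i) t : R) *: c i)|).
Proof.
move=> mA mD; elim: n v => [|n IH] v.
  under eq_fun do rewrite big_ord0; exact: measurable_cst.
rewrite (_ : (fun t => _) = (fun t =>
    \1_(A n) t * `|v + c n + \sum_(i < n) ((\1_(A i) t : R) *: c i)| +
    (1 - \1_(A n) t) * `|v + \sum_(i < n) ((\1_(A i) t : R) *: c i)|)).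
  apply: measurable_funD; apply: measurable_funM; rewrite //.
  apply: measurable_funB; first exact: measurable_cst.
  exact: measurable_indic.
apply/funext => t; rewrite big_ord_recr/= indicE; case: (t \in A n).
  by rewrite !scale1r mul1r subrr mul0r addr0 addrAC addrA.
by rewrite scale0r addr0 mul0r add0r subr0 mul1r.
Qed.

Lemma strongly_measurable_norm (D : set (measurableTypeR R)) (g : R -> V) :
  measurable D -> strongly_measurable D g -> measurable_fun D (fun t => `|g t|).
Proof.
move=> mD [k [A [c [mA cv]]]].
apply: (@measurable_fun_cvg _ _ _ D
  (fun n t => `|0 + \sum_(i < k n) ((\1_(A n i) t : R) *: c n i)|)).
- by move=> n; exact: measurable_norm_simple.
- move=> t Dt; under eq_fun do rewrite add0r.
  by apply: cvg_norm; exact: cv.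
Qed.

End StronglyMeasurable.

(** * Functions dominated by the velocity and time *)

Section Dominated.
Context {R : realType} {H : completeNormedModType R}.
Variables (ip : H -> H -> R) (y : R -> H).
Hypothesis hip : is_inner_product ip.
Hypothesis acy : forall T, 0 <= T -> abs_continuous_on 0 T y.
Implicit Types (a b s t : R).

(** Composition with this retraction extends functions controlled only at nonnegative times to
    functions continuous on the whole line. *)
Definition posr t : R := Num.max 0 t.

Lemma posr_ge0 t : 0 <= posr t. Proof. by rewrite le_max lexx. Qed.

Lemma posr_id t : 0 <= t -> posr t = t. Proof. by move=> /max_idPr. Qed.

Lemma posr_contract s t : `|posr s - posr t| <= `|s - t|.
Proof.
rewrite /posr; have [s0|s0] := leP 0 s; have [t0|t0] := leP 0 t => //.
- rewrite subr0 !ger0_norm//; lra.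
- rewrite sub0r normrN distrC !ger0_norm//; lra.
- by rewrite subrr normr0.
Qed.

Lemma posr_continuous : continuous posr.
Proof.
move=> t; apply/cvgrPdist_le => e e0.
have : s @[s --> t] --> t by exact: cvg_id.
move=> /cvgrPdist_le/(_ e e0); apply: filterS => s.
exact: le_trans (posr_contract _ _).
Qed.

Lemma abs_continuousS (V : normedModType R) (f : R -> V) a b a' b' :
  a <= a' -> b' <= b -> abs_continuous_on a b f -> abs_continuous_on a' b' f.
Proof.
move=> aa bb acf e e0; have [d d0 Hd] := acf e e0; exists d => // n u v uv.
apply: Hd => i; have [? [? ?]] := uv i.
by split; [exact: le_trans aa _|split=> //; exact: le_trans bb].
Qed.

Lemma abs_continuous_posr_continuous : continuous (fun t => y (posr t)).
Proof.
move=> t; apply/cvgrPdist_le => e e0.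
have [d d0 Hd] := acy (posr_ge0 (t + 1)) e0.
have t1 : t <= posr (t + 1) by rewrite le_max; apply/orP; right; lra.
have H1 u v : 0 <= u -> u <= v -> v <= posr (t + 1) -> v - u < d ->
    `|y v - y u| <= e.
  move=> u0 uv v1 vud.
  have := Hd 1%N (fun=> u) (fun=> v); rewrite !big_ord1 => /(_ _ _ vud) h.
  by apply/ltW/h => // i j; rewrite !ord1.
near=> s.
have st : `|t - s| < d by near: s; apply: cvgr_dist_lt => //; exact: cvg_id.
have s1 : `|t - s| < 1 by near: s; apply: cvgr_dist_lt => //; exact: cvg_id.
have pt : posr t <= posr (t + 1).
  by rewrite /posr ge_max le_max lexx/=.
have ps : posr s <= posr (t + 1).
  rewrite /posr ge_max !le_max lexx/=; apply/orP; right.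
  by move: s1; rewrite ltr_norml => /andP[]; lra.
have pst := le_lt_trans (posr_contract t s) st.
have [ts|/ltW ts] := leP (posr s) (posr t).
  by apply: H1 => //; [exact: posr_ge0|move: pst; rewrite ger0_norm ?subr_ge0].
rewrite distrC; apply: H1 => //; first exact: posr_ge0.
by move: pst; rewrite distrC ger0_norm ?subr_ge0.
Unshelve. all: by end_near. Qed.

Lemma continuous_bounded_itv (V : normedModType R) (f : R -> V) a b :
  continuous f -> exists2 B : R, 0 <= B & forall t, a <= t <= b -> `|f t| <= B.
Proof.
move=> cf; have [ab|ba] := leP a b; last first.
  exists 0 => // t /andP[at_ tb].
  by move: (lt_le_trans ba (le_trans at_ tb)); rewrite ltxx.
have cn : {within `[a, b], continuous (fun t => `|f t|)}.
  by apply: continuous_subspaceT => t; apply: cvg_norm; exact: cf.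
have [c _ Hc] := EVT_max ab cn.
by exists `|f c| => // t tab; apply: Hc; rewrite in_itv.
Qed.

(** A class that contains the velocity, is stable under sums and products, and consists of
    absolutely continuous functions when [0 <= a]. Increment bounds propagate more easily than
    conditions on families of intervals. *)
Definition dominated (V : normedModType R) a b (f : R -> V) :=
  exists2 L : R, 0 <= L & forall u v, a <= u -> u <= v -> v <= b ->
    `|f v - f u| <= L * (`|y v - y u| + `|v - u|).

Lemma dominated_bounded (V : normedModType R) a b (f : R -> V) : 0 <= a ->
  dominated a b f -> exists2 B : R, 0 <= B & forall t, a <= t <= b -> `|f t| <= B.
Proof.
move=> a0 [L L0 HL].
have [B B0 HB] := continuous_bounded_itv a b abs_continuous_posr_continuous.
have yB t : a <= t <= b -> `|y t| <= B.
  by move=> /[dup] /HB + /andP[at_ _]; rewrite posr_id// (le_trans a0).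
exists (`|f a| + L * (B + B + `|b - a|)) => [|t /[dup] tab /andP[at_ tb]].
  by rewrite addr_ge0// mulr_ge0// !addr_ge0.
have ab := le_trans at_ tb.
rewrite -[f t](subrK (f a)) addrC; apply: le_trans (ler_normD _ _) _.
rewrite lerD2l; apply: le_trans (HL a t _ _ _) _ => //.
apply: ler_wpM2l => //; apply: lerD.
  by apply: le_trans (ler_normB _ _) _; apply: lerD; apply: yB; rewrite ?at_// lexx.
by rewrite !ger0_norm ?subr_ge0// lerD2r.
Qed.

Lemma dominated_cst (V : normedModType R) a b (v : V) : dominated a b (fun=> v).
Proof. by exists 0 => // *; rewrite subrr normr0 mul0r. Qed.

Lemma dominated_self a b : dominated a b y.
Proof. by exists 1 => // *; rewrite mul1r lerDl. Qed.

Lemma dominatedD (V : normedModType R) a b (f g : R -> V) :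
  dominated a b f -> dominated a b g -> dominated a b (fun t => f t + g t).
Proof.
move=> [L L0 HL] [M M0 HM]; exists (L + M); first exact: addr_ge0.
move=> u v au uv vb; rewrite opprD addrACA mulrDl.
by apply: le_trans (ler_normD _ _) _; rewrite lerD ?HL ?HM.
Qed.

Lemma dominatedN (V : normedModType R) a b (f : R -> V) :
  dominated a b f -> dominated a b (fun t => - f t).
Proof.
move=> [L L0 HL]; exists L => // u v au uv vb.
by rewrite -opprD normrN; exact: HL.
Qed.

(** Splits the increment as in the Leibniz rule and bounds the undifferenced factors; [B] will be
    both the product of reals and [ip]. *)
Lemma dominated_bilinear (U V W : normedModType R) (B : U -> V -> W) a b
    (f : R -> U) (g : R -> V) : 0 <= a ->
  (forall u v w, B (u - v) w = B u w - B v w) ->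
  (forall u v w, B u (v - w) = B u v - B u w) ->
  (forall u v, `|B u v| <= `|u| * `|v|) ->
  dominated a b f -> dominated a b g -> dominated a b (fun t => B (f t) (g t)).
Proof.
move=> a0 Bl Br Bn df dg.
have [Bf Bf0 HBf] := dominated_bounded a0 df.
have [Bg Bg0 HBg] := dominated_bounded a0 dg.
move: df dg => [L L0 HL] [M M0 HM].
exists (L * Bg + Bf * M); first by rewrite addr_ge0// mulr_ge0.
move=> u v au uv vb.
rewrite (_ : _ - _ = B (f v - f u) (g v) + B (f u) (g v - g u)); last first.
  by rewrite Bl Br addrA subrK.
apply: le_trans (ler_normD _ _) _; rewrite mulrDl; apply: lerD.
  apply: le_trans (Bn _ _) _; rewrite mulrAC; apply: ler_pM => //; first exact: HL.
  by apply: HBg; rewrite vb (le_trans au).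
apply: le_trans (Bn _ _) _; rewrite -mulrA; apply: ler_pM => //; last exact: HM.
by apply: HBf; rewrite au (le_trans uv).
Qed.

Lemma dominatedM a b (f g : R -> R) : 0 <= a ->
  dominated a b f -> dominated a b g -> dominated a b (fun t => f t * g t).
Proof.
move=> a0; apply: (@dominated_bilinear _ _ _ (fun u v : R => u * v)) => // u v.
- by move=> w; rewrite mulrBl.
- by move=> w; rewrite mulrBr.
- by rewrite normrM.
Qed.

Lemma dominated_ip a b (f g : R -> H) : 0 <= a ->
  dominated a b f -> dominated a b g -> dominated a b (fun t => ip (f t) (g t)).
Proof.
move=> a0; apply: (@dominated_bilinear _ _ _ ip) => // u v.
- by move=> w; exact: ipBl.
- by move=> w; exact: ipBr.
- exact: ip_CauchySchwarz.
Qed.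

Lemma MVT_norm_le (f df : R -> R) a b (B : R) :
  (forall t, a <= t <= b -> is_derive t (1 : R) f (df t)) ->
  (forall t, a <= t <= b -> `|df t| <= B) ->
  forall u v, a <= u -> u <= v -> v <= b -> `|f v - f u| <= B * `|v - u|.
Proof.
move=> Df dB u v au uv vb.
have uvab t : u <= t <= v -> a <= t <= b.
  by move=> /andP[? ?]; rewrite (le_trans au)//= (le_trans _ vb).
have [||t] := @MVT_segment _ f df u v uv.
- by move=> t; rewrite in_itv/= => /andP[? ?]; apply/Df/uvab; rewrite !ltW.
- apply: derivable_within_continuous => t; rewrite in_itv/= => /uvab /Df.
  by case.
rewrite in_itv/= => /uvab /dB tB ->.
by rewrite normrM ler_wpM2r.
Qed.

Lemma dominated_derive a b (f df : R -> R) (B : R) :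
  (forall t, a <= t <= b -> is_derive t (1 : R) f (df t)) ->
  (forall t, a <= t <= b -> `|df t| <= B) -> dominated a b f.
Proof.
move=> Df dB; exists `|B| => // u v au uv vb.
apply: le_trans (MVT_norm_le Df dB _ _ _) _ => //.
apply: (@le_trans _ _ (`|B| * `|v - u|)); first by rewrite ler_wpM2r ?ler_norm.
by rewrite ler_wpM2l// lerDr.
Qed.

(** A mean value inequality in [H]: paired with its own increment [w], [f] becomes a real function
    whose increment is [|w|^2] and whose derivative is at most [B |w|] in absolute value. *)
Lemma dominated_primitive a b (f : R -> H) : 0 <= a ->
  (forall t, 0 <= t -> is_derive t (1 : R) f (y t)) -> dominated a b f.
Proof.
move=> a0 Df.
have [B B0 HB] := dominated_bounded a0 (dominated_self a b).
exists B => // u v au uv vb.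
set w := f v - f u.
have [->|w0] := eqVneq w 0; first by rewrite normr0 mulr_ge0// addr_ge0.
apply: (@le_trans _ _ (B * `|v - u|)); last by rewrite ler_wpM2l// lerDr.
rewrite -(ler_pM2l (_ : 0 < `|w|)) ?normr_gt0//.
have Dw t : a <= t <= b -> is_derive t (1 : R) (fun s => ip (f s) w) (ip (y t) w).
  move=> /andP[at_ _].
  have := is_derive_ip hip (Df t (le_trans a0 at_)) (is_derive_cst w t 1).
  by rewrite (ipC hip _ 0) (ip0l hip) addr0.
have yw t : a <= t <= b -> `|ip (y t) w| <= B * `|w|.
  by move=> /HB h; apply: le_trans (ip_CauchySchwarz hip _ _) _; rewrite ler_wpM2r.
have := MVT_norm_le Dw yw au uv vb.
rewrite -(ipBl hip) -/w -(normip_sqr hip) ger0_norm ?sqr_ge0// expr2.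
by rewrite (mulrC B) -mulrA.
Qed.

Lemma dominated_lipschitz a b (k : R -> R) (f : R -> R) :
  (forall u v, a <= u -> u <= v -> v <= b -> `|k v - k u| <= `|f v - f u|) ->
  dominated a b f -> dominated a b k.
Proof.
move=> kf [L L0 HL]; exists L => // u v au uv vb.
exact: le_trans (kf _ _ au uv vb) (HL _ _ au uv vb).
Qed.

Lemma dominated_abs_continuous (V : normedModType R) a b (f : R -> V) :
  0 <= a -> dominated a b f -> abs_continuous_on a b f.
Proof.
move=> a0 [L _ HL]; have [ab|ba] := leP a b.
  apply: (abs_continuous_dom (y := y) (z := fun t : R => t)) HL.
    exact: abs_continuousS a0 (lexx _) (acy (le_trans a0 ab)).
  exact: abs_continuous_id.
(* When [b < a], only the empty family of intervals fits. *)
move=> e e0; exists 1 => // -[|n] u v uv; first by rewrite !big_ord0.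
have [h1 [h2 h3]] := uv ord0.
by move: (lt_le_trans ba (le_trans h1 (le_trans h2 h3))); rewrite ltxx.
Qed.

End Dominated.

(** * Energy estimates along a trajectory *)

Section RealDerive.
Context {R : realType}.
Implicit Types (f g : R -> R) (t a b : R).

Lemma is_derive1D f g t a b : is_derive t (1 : R) f a -> is_derive t (1 : R) g b ->
  is_derive t (1 : R) (fun s => f s + g s) (a + b).
Proof. by move=> df dg; exact: is_deriveD. Qed.

Lemma is_derive1M f g t a b : is_derive t (1 : R) f a -> is_derive t (1 : R) g b ->
  is_derive t (1 : R) (fun s => f s * g s) (a * g t + f t * b).
Proof.
move=> df dg; apply: (is_derive_eq (is_deriveM df dg)).
by rewrite /GRing.scale/= addrC (mulrC a).
Qed.

Lemma is_derive1Ml (k : R) f t a : is_derive t (1 : R) f a ->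
  is_derive t (1 : R) (fun s => k * f s) (k * a).
Proof.
move=> df; apply: (is_derive_eq (is_derive1M (is_derive_cst k t 1) df)).
by rewrite mul0r add0r.
Qed.

Lemma nonincreasing_cvg_pinfty f (T m : R) :
  (forall s t, T <= s -> s <= t -> f t <= f s) -> (forall t, T <= t -> m <= f t) ->
  exists l : R, f t @[t --> +oo] --> l.
Proof.
move=> fnon fm.
pose g t := - f (Num.max T t).
have gmon : {homo g : s t / s <= t}.
  move=> s t st; rewrite lerN2; apply: fnon; first by rewrite le_max lexx.
  by rewrite ge_max !le_max lexx st orbT.
have gub : has_ubound (range g).
  exists (- m) => _ [t _ <-]; rewrite lerN2; apply: fm; by rewrite le_max lexx.
exists (- sup (range g)).
have gc : - g t @[t --> +oo] --> - sup (range g).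
  by apply: cvgN; exact: nondecreasing_cvgr.
apply/cvgrPdist_le => e e0; move/cvgrPdist_le : gc => /(_ e e0)[M [_ HM]].
exists (Num.max M T); split; first exact: num_real.
move=> t; rewrite gt_max => /andP[Mt Tt]; have := HM t Mt.
by rewrite /g/= opprK (max_idPr (ltW Tt)).
Qed.

Lemma le_1Dsqr a : a <= 1 + a ^+ 2.
Proof. by have := sqr_ge0 (a - 2^-1); rewrite sqrrB; lra. Qed.

Lemma squeeze0_pinfty f g (T : R) : (forall t, T <= t -> `|f t| <= g t) ->
  g t @[t --> +oo] --> 0 -> f t @[t --> +oo] --> 0.
Proof.
move=> fg g0; apply/cvgrPdist_le => e e0.
move/cvgrPdist_le : g0 => /(_ e e0)[M [_ HM]].
exists (Num.max M T); split; first exact: num_real.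
move=> t; rewrite gt_max => /andP[Mt Tt]; have := HM t Mt.
rewrite !sub0r !normrN; apply: le_trans.
exact: le_trans (fg t (ltW Tt)) (ler_norm _).
Qed.

Lemma ln1p_contract a b : 0 <= a -> 0 <= b -> `|ln (1 + b) - ln (1 + a)| <= `|b - a|.
Proof.
wlog ab : a b / a <= b.
  move=> hw a0 b0; have [/hw|/ltW /hw] := leP a b; first exact.
  by rewrite distrC (distrC b); apply.
move=> a0 b0.
have a1 : 0 < 1 + a by rewrite ltr_wpDr.
have b1 : 0 < 1 + b by rewrite ltr_wpDr.
rewrite !ger0_norm ?subr_ge0 ?ler_ln ?posrE ?lerD2l//.
rewrite -ln_div ?posrE//.
have -> : (1 + b) / (1 + a) = 1 + (b - a) / (1 + a) by field; rewrite gt_eqF.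
apply: le_trans (le_ln1Dx _) _.
  by rewrite (@lt_le_trans _ _ 0) ?ltrN10// divr_ge0 ?subr_ge0// ltW.
by rewrite ler_pdivrMr// ler_peMr ?subr_ge0// lerDl.
Qed.

End RealDerive.

Section Trajectory.
Context {R : realType} {H : completeNormedModType R}.
Implicit Types (r s t : R).
Notation mu := (@lebesgue_measure R).
Variables (ip : H -> H -> R) (Phi : H -> R) (G : H -> H) (Phistar : R).
Hypothesis hip : is_inner_product ip.
Hypothesis hconv : convex_fun Phi.
Hypothesis hgrad : is_gradient ip Phi G.
Hypothesis contG : continuous G.
Hypothesis hmin : forall u, Phistar <= Phi u.
Variables (c : R) (lam l1 l2 : R -> R).
Hypothesis c0 : 0 < c.
Hypothesis lamD : forall t : R, 0 <= t -> is_derive t (1 : R) lam (l1 t).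
Hypothesis l1D : forall t : R, 0 <= t -> is_derive t (1 : R) l1 (l2 t).
Hypothesis lam_bnd : forall t : R, 0 <= t -> 1 <= lam t <= 1 + t.
Hypothesis l1_bnd : forall t : R, 0 <= t -> 0 <= l1 t <= 1.
Hypothesis l2_bnd : forall t : R, 0 <= t -> -1 <= l2 t <= 0.
Hypothesis l1_cvg0 : l1 t @[t --> +oo] --> 0.
Variables (x y : R -> H) (h : R -> R).
Hypothesis xD : forall t : R, 0 <= t -> is_derive t (1 : R) x (y t).
Hypothesis acy : forall T, 0 <= T -> abs_continuous_on 0 T y.
Hypothesis h0 : forall t, 0 <= h t.
Hypothesis ih : mu.-integrable setT (EFin \o h).

(* [v] is the value of the forcing term at [t] *)
Definition solves_at (t : R) (v : H) :=
  is_derive t (1 : R) y (v - (c / lam t) *: y t - G (x t)) /\ lam t * `|v| <= h t.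

Hypothesis eqn : {ae mu, forall t, 0 <= t -> exists v, solves_at t v}.

Definition energy t := 2^-1 * `|y t| ^+ 2 + Phi (x t) - Phistar.
Local Notation W := energy.

Definition wenergy t := lam (posr t) * W (posr t).

(** Starting at -1 puts 0 in the interior, so that a two-sided derivative exists there too. *)
Definition wenergy_primitive t := (\int[mu]_(s in `[(-1)%R, t]) wenergy s)%R.
Local Notation J := wenergy_primitive.

Lemma energyE t : W t = 2^-1 * ip (y t) (y t) + Phi (x t) - Phistar.
Proof. by rewrite /energy (normip_sqr hip). Qed.

Lemma lam_gt0 t : 0 <= t -> 0 < lam t.
Proof. by move=> /lam_bnd/andP[? _]; exact: lt_le_trans. Qed.

Lemma energy_ge t : 2^-1 * `|y t| ^+ 2 <= W t.
Proof. by rewrite /energy -addrA lerDl subr_ge0. Qed.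

Lemma energy_ge_gap t : Phi (x t) - Phistar <= W t.
Proof. by rewrite /energy -addrA lerDr mulr_ge0// sqr_ge0. Qed.

Lemma energy_ge0 t : 0 <= W t.
Proof. by apply: le_trans (energy_ge t); rewrite mulr_ge0// sqr_ge0. Qed.

Lemma continuous_posr_comp (V : normedModType R) (f : R -> V) (df : R -> V) :
  (forall t : R, 0 <= t -> is_derive t (1 : R) f (df t)) ->
  continuous (fun t => f (posr t)).
Proof.
move=> Df t; apply: cvg_comp (@posr_continuous R t) _.
exact: is_derive1_continuous (Df _ (posr_ge0 t)).
Qed.

Lemma wenergy_continuous : continuous wenergy.
Proof.
move=> t; apply: cvgM; first exact: continuous_posr_comp lamD t.
rewrite (_ : (fun s => _) = fun s => 2^-1 * ip (y (posr s)) (y (posr s)) +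
    Phi (x (posr s)) - Phistar); last by apply/funext => s; rewrite energyE.
rewrite energyE; apply: cvgB; last exact: cvg_cst.
have yc := abs_continuous_posr_continuous acy.
apply: cvgD; last first.
  apply: (@continuous_comp _ _ _ (fun s => x (posr s)) Phi).
    exact: continuous_posr_comp xD t.
  exact: (gradient_continuous hip hgrad).
apply: cvgM; first exact: cvg_cst.
by apply: (cvg_ip hip); exact: yc.
Qed.

Lemma wenergy_primitive_derive t : 0 <= t ->
  is_derive t (1 : R) J (lam t * W t).
Proof.
move=> t0; have t1 : t < t + 1 by rewrite ltrDl.
have it : mu.-integrable `[(-1)%R, (t + 1)%R] (EFin \o wenergy).
  apply: continuous_compact_integrable; first exact: segment_compact.
  by apply: continuous_subspaceT; exact: wenergy_continuous.
have t10 : -1 < t by apply: lt_le_trans t0; exact: ltrN10.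
have [dJ JE] := continuous_FTC1_closed t1 it t10 (@wenergy_continuous t).
have -> : lam t * W t = J^`()%classic t by rewrite JE /wenergy posr_id.
by rewrite derive1E; exact: derivableP.
Qed.

(** * Absolute continuity of the terms of the energy *)

Section dominated_pieces.
Variables (a b : R).
Hypothesis a0 : 0 <= a.

Let ge0ab t : a <= t <= b -> 0 <= t.
Proof. by move=> /andP[/(le_trans a0)]. Qed.

Lemma dominated_lam : dominated y a b lam.
Proof.
apply: (@dominated_derive _ _ _ _ _ _ l1 1) => t /ge0ab t0; first exact: lamD.
by have /andP[? ?] := l1_bnd t0; rewrite ger0_norm.
Qed.

Lemma dominated_l1 : dominated y a b l1.
Proof.
apply: (@dominated_derive _ _ _ _ _ _ l2 1) => t /ge0ab t0; first exact: l1D.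
have /andP[? ?] := l2_bnd t0; rewrite ler_norml; apply/andP; split=> //.
exact: le_trans ler01.
Qed.

Lemma dominated_x : dominated y a b x.
Proof. exact: dominated_primitive hip acy _ _ _ a0 xD. Qed.

(** Continuity of [G] bounds the gradient along the trajectory on compact time intervals, hence also
    the derivative [<G x, y>]. *)
Lemma dominated_Phi : dominated y a b (fun t => Phi (x t)).
Proof.
have [B1 B10 HB1] := continuous_bounded_itv a b (abs_continuous_posr_continuous acy).
have cGx : continuous (fun t => G (x (posr t))).
  move=> t; apply: (@continuous_comp _ _ _ (fun s => x (posr s)) G); last exact: contG.
  exact: continuous_posr_comp xD t.
have [B2 B20 HB2] := continuous_bounded_itv a b cGx.
apply: (@dominated_derive _ _ _ _ _ _ (fun t => ip (G (x t)) (y t)) (B2 * B1)) => t tab.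
  by apply: (is_derive_gradient hip hgrad); exact: xD (ge0ab tab).
apply: le_trans (ip_CauchySchwarz hip _ _) _.
have := HB1 t tab; have := HB2 t tab; rewrite posr_id ?(ge0ab tab)// => ? ?.
exact: ler_pM.
Qed.

Lemma dominated_energy : dominated y a b W.
Proof.
rewrite (_ : W = fun t => 2^-1 * ip (y t) (y t) + Phi (x t) + (- Phistar)); last first.
  by apply/funext => t; rewrite energyE.
apply: dominatedD; last exact: dominated_cst.
apply: dominatedD; last exact: dominated_Phi.
apply: dominatedM => //; first exact: dominated_cst.
by apply: dominated_ip => //; exact: dominated_self.
Qed.

Lemma dominated_wenergy_primitive : dominated y a b J.
Proof.
have [B B0 HB] := continuous_bounded_itv a b wenergy_continuous.
apply: (@dominated_derive _ _ _ _ _ _ (fun t => lam t * W t) B) => t tab.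
  exact: wenergy_primitive_derive (ge0ab tab).
by have := HB t tab; rewrite /wenergy posr_id ?(ge0ab tab).
Qed.

End dominated_pieces.

(** Integrates an almost everywhere inequality [f' <= A h - B lam W]: the function
    [f + B J - A primitive h] is absolutely continuous with nonpositive derivative almost
    everywhere. Negative [B] is allowed and will serve to bound [J] from below. *)
Lemma increment_le (f : R -> R) s t (A B : R) : 0 <= s -> s <= t ->
  dominated y s t f ->
  (forall r v, s <= r <= t -> solves_at r v ->
    exists2 d, is_derive r (1 : R) f d & d <= A * h r - B * (lam r * W r)) ->
  f t - f s <= A * (primitive h t - primitive h s) - B * (J t - J s).
Proof.
move=> s0 st df Hd.
pose k r := f r + B * J r + (- A) * primitive h r.
suff : k t <= k s by rewrite /k; lra.
apply: abs_continuous_le0_derive_nincr => //.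
  apply: (@abs_continuous_dom _ _ _ _ (fun r => f r + B * J r) (primitive h) k _ _ (1 + `|A|)).
  - apply: (@dominated_abs_continuous _ _ y) => //; apply: dominatedD => //.
    apply: dominatedM => //; first exact: dominated_cst.
    exact: dominated_wenergy_primitive.
  - exact: abs_continuous_primitive.
  - move=> u v su uv vt; rewrite /k.
    rewrite (_ : _ - _ = (f v + B * J v - (f u + B * J u)) +
      (- A) * (primitive h v - primitive h u)); last by ring.
    apply: le_trans (ler_normD _ _) _; rewrite normrM normrN.
    rewrite mulrDr; apply: lerD.
      by rewrite ler_peMl// lerDl.
    by rewrite ler_wpM2r// lerDr.
have := primitive_derive_ae ih.
move: eqn; apply: filterS2; first exact: (ae_filter_ringOfSetsType mu).
move=> r Hr Hp /andP[sr rt]; have r0 := le_trans s0 sr.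
have [v sv] := Hr r0; have [|d fd dle] := Hd r v _ sv; first by rewrite sr.
exists (d + B * (lam r * W r) + (- A) * h r); last lra.
exact: is_derive1D (is_derive1D fd (is_derive1Ml B (wenergy_primitive_derive r0)))
  (is_derive1Ml (- A) Hp).
Qed.

Lemma energy_derive t v : 0 <= t -> solves_at t v ->
  is_derive t (1 : R) W (ip (y t) v - c / lam t * ip (y t) (y t)).
Proof.
move=> t0 [Dy _].
rewrite (_ : W = fun t => 2^-1 * ip (y t) (y t) + Phi (x t) + (- Phistar)); last first.
  by apply/funext => s; rewrite energyE.
have Dyy := is_derive1Ml 2^-1 (is_derive_ip hip Dy Dy).
have DPhi := is_derive_gradient hip hgrad (xD t0).
apply: (is_derive_eq (is_derive1D (is_derive1D Dyy DPhi) (is_derive_cst (- Phistar) t 1))).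
rewrite !(ipC hip _ (y t)) !(ipBr hip) (ipZr hip); field.
by rewrite gt_eqF// lam_gt0.
Qed.

(** * The Lyapunov function attached to a minimizer *)

Section lyapunov.
Variable z : H.
Hypothesis hz : Phi z = Phistar.

(* [K * c = 8] makes the discriminant in [lyapunov_ge] vanish *)
Let K := 8 / c.

Let Kc : K * c = 8. Proof. by rewrite divfK// gt_eqF. Qed.

Let K0 : 0 < K. Proof. exact: divr_gt0. Qed.

Let K20 : 0 <= K / 2. Proof. by rewrite ltW// divr_gt0. Qed.

Definition lyapunov t := K * (lam t ^+ 2 * W t) + lam t * ip (y t) (x t - z) +
  2^-1 * ((c - l1 t) * ip (x t - z) (x t - z)).
Local Notation F := lyapunov.

Lemma dominated_lyapunov a b : 0 <= a -> dominated y a b F.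
Proof.
move=> a0.
have dxz : dominated y a b (fun t => x t - z).
  by apply: dominatedD; [exact: dominated_x|exact: dominated_cst].
apply: dominatedD; first apply: dominatedD.
- apply: dominatedM => //; first exact: dominated_cst.
  apply: dominatedM => //; last exact: dominated_energy.
  by apply: dominatedM => //; exact: dominated_lam.
- apply: dominatedM => //; first exact: dominated_lam.
  by apply: dominated_ip => //; exact: dominated_self.
- apply: dominatedM => //; first exact: dominated_cst.
  apply: dominatedM => //; last exact: dominated_ip.
  apply: dominatedD; first exact: dominated_cst.
  by apply: dominatedN; exact: dominated_l1.
Qed.

Lemma lyapunov_derive t v : 0 <= t -> solves_at t v ->
  is_derive t (1 : R) F (2 * K * lam t * l1 t * W t + K * lam t ^+ 2 * ip (y t) v
    - K * c * lam t * ip (y t) (y t) + lam t * ip v (x t - z)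
    - lam t * ip (G (x t)) (x t - z) + lam t * ip (y t) (y t)
    - 2^-1 * l2 t * ip (x t - z) (x t - z)).
Proof.
move=> t0 tv; have DW := energy_derive t0 tv; case: tv => [Dy _].
have Dl := lamD t0; have Dl1 := l1D t0.
have Dx : is_derive t (1 : R) (fun s => x s - z) (y t).
  apply: (is_derive_eq (is_deriveD (xD t0) (is_derive_cst (- z) t 1))).
  by rewrite addr0.
have D1 := is_derive1Ml K (is_derive1M (is_derive1M Dl Dl) DW).
have D2 := is_derive1M Dl (is_derive_ip hip Dy Dx).
have Dc : is_derive t (1 : R) (fun s => c - l1 s) (- l2 t).
  apply: (is_derive_eq (is_deriveB (is_derive_cst c t 1) Dl1)).
  by rewrite sub0r.
have D3 := is_derive1Ml 2^-1 (is_derive1M Dc (is_derive_ip hip Dx Dx)).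
apply: (is_derive_eq (is_derive1D (is_derive1D D1 D2) D3)).
rewrite (ipC hip (x t - z) (y t)) !(ipBl hip) (ipZl hip); field.
by rewrite gt_eqF// lam_gt0.
Qed.

Let X t := `|x t - z|.
Let Y t := `|y t|.

Let ip_xz t : ip (x t - z) (x t - z) = X t ^+ 2.
Proof. by rewrite /X (normip_sqr hip). Qed.

Let ip_yy t : ip (y t) (y t) = Y t ^+ 2.
Proof. by rewrite /Y (normip_sqr hip). Qed.

(** The first bound keeps the coefficient of [|x - z|^2] in [F] at least [c / 4]; the second lets
    half of [lam W] absorb the growth [2 K lam lam' W] due to the weight. *)
Let small t := l1 t <= c / 2 /\ 2 * K * l1 t <= 2^-1.

(** Half of each quadratic term absorbs the cross term, through the square
    [K / 4 (lam Y - c / 4 X)^2]; the other halves remain. *)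
Lemma lyapunov_ge t : 0 <= t -> small t ->
  K / 2 * (lam t ^+ 2 * W t) + c / 8 * X t ^+ 2 <= F t.
Proof.
move=> t0 [s1 _]; rewrite /lyapunov ip_xz.
have l0 := lam_gt0 t0.
have hP : - (lam t * Y t * X t) <= lam t * ip (y t) (x t - z).
  rewrite -mulrA -mulrN ler_wpM2l ?(ltW l0)//.
  have := ip_CauchySchwarz hip (y t) (x t - z).
  by rewrite ler_norml => /andP[].
have hW : K / 2 * (lam t ^+ 2 * (2^-1 * Y t ^+ 2)) <= K / 2 * (lam t ^+ 2 * W t).
  rewrite ler_wpM2l ?K20// ler_wpM2l ?sqr_ge0//.
  exact: energy_ge.
have sq : 0 <= K / 4 * (lam t * Y t - c / 4 * X t) ^+ 2.
  by rewrite mulr_ge0 ?sqr_ge0// ltW// divr_gt0.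
have sqE : K / 4 * (lam t * Y t - c / 4 * X t) ^+ 2 =
    K / 2 * (lam t ^+ 2 * (2^-1 * Y t ^+ 2)) - lam t * Y t * X t + c / 8 * X t ^+ 2.
  by rewrite /K; field; rewrite gt_eqF.
have lX : l1 t * X t ^+ 2 <= c / 2 * X t ^+ 2 by rewrite ler_wpM2r ?sqr_ge0.
move: hP hW sq lX; rewrite sqE; lra.
Qed.

Lemma lyapunov_ge0 t : 0 <= t -> small t -> 0 <= F t.
Proof.
move=> t0 st; apply: le_trans (lyapunov_ge t0 st).
have c8 : 0 <= c / 8 by rewrite ltW// divr_gt0.
apply: addr_ge0; apply: mulr_ge0; rewrite ?K20 ?c8 ?sqr_ge0//.
by apply: mulr_ge0; [exact: sqr_ge0|exact: energy_ge0].
Qed.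

(** The gradient inequality yields [- lam W + lam Y^2 / 2] and the cross term yields [lam Y^2]; the
    damping contributes [- 8 lam Y^2], more than enough to cover both. *)
Lemma lyapunov_derive_le t v : 0 <= t -> small t -> solves_at t v ->
  exists2 d, is_derive t (1 : R) F d &
    d <= h t * (X t + K * (lam t * Y t)) - 2^-1 * (lam t * W t)
         - 2^-1 * l2 t * X t ^+ 2.
Proof.
move=> t0 [_ s2] tv; have D := lyapunov_derive t0 tv; case: tv => _ hv.
eexists; first exact: D.
have l0 := lam_gt0 t0; have W0 := energy_ge0 t.
have lW : 0 <= lam t * W t by rewrite mulr_ge0// ltW.
have p1 : 2 * K * lam t * l1 t * W t <= 2^-1 * (lam t * W t).
  rewrite (_ : 2 * K * lam t * l1 t * W t = 2 * K * l1 t * (lam t * W t)); last by ring.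
  by rewrite ler_wpM2r.
have p2 : K * lam t ^+ 2 * ip (y t) v <= h t * (K * (lam t * Y t)).
  apply: (@le_trans _ _ (K * (lam t * Y t) * (lam t * `|v|))).
    rewrite (_ : K * (lam t * Y t) * (lam t * `|v|) = K * lam t ^+ 2 * (Y t * `|v|)); last by ring.
    apply: ler_wpM2l; last exact: ip_le.
    by apply: mulr_ge0; [exact: ltW|exact: sqr_ge0].
  rewrite mulrC; apply: ler_wpM2r => //.
  apply: mulr_ge0; first exact: ltW.
  by apply: mulr_ge0; [exact: ltW|exact: normr_ge0].
have p3 : lam t * ip v (x t - z) <= h t * X t.
  apply: (@le_trans _ _ (lam t * `|v| * X t)).
    by rewrite -mulrA; apply: ler_wpM2l; [exact: ltW|exact: ip_le].
  by apply: ler_wpM2r => //; exact: normr_ge0.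
have p4 : lam t * (W t - 2^-1 * Y t ^+ 2) <= lam t * ip (G (x t)) (x t - z).
  rewrite ler_wpM2l ?(ltW l0)//.
  have := gradient_inequality hip hconv hgrad (x t) z.
  rewrite -opprB (ipNr hip) hz /energy /Y; lra.
have p5 : 0 <= lam t * Y t ^+ 2 by rewrite mulr_ge0 ?sqr_ge0// ltW.
rewrite Kc ip_xz ip_yy; move: p1 p2 p3 p4 p5; lra.
Qed.

Let smallP : exists2 T, 0 <= T & forall t, T <= t -> small t.
Proof.
pose e := Num.min (c / 2) (2^-1 / (2 * K)).
have K2 : 0 < 2 * K by rewrite mulr_gt0.
have e0 : 0 < e by rewrite lt_min !divr_gt0.
move/cvgrPdist_le : l1_cvg0 => /(_ e e0)[M [_ HM]].
exists (Num.max 0 (M + 1)); first by rewrite le_max lexx.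
move=> t; rewrite ge_max => /andP[t0 Mt]; have := HM t; rewrite /= => /(_ ltac:(lra)).
rewrite sub0r normrN => /(le_trans (ler_norm _)); rewrite le_min => /andP[? h2].
by split=> //; rewrite mulrC -ler_pdivlMr.
Qed.

Let I := (\int[mu]_s h s)%R.

Let primI s t : primitive h t - primitive h s <= I.
Proof.
have /andP[_ h1] := primitive_bounded h0 ih t.
by have /andP[h2 _] := primitive_bounded h0 ih s; rewrite /I; lra.
Qed.

Lemma wenergy_primitive_nondecreasing s t : 0 <= s -> s <= t -> J s <= J t.
Proof.
move=> s0 st.
(* For the zero function with [A = 0] and [B = -1], the increment bound reads [0 <= J t - J s]. *)
have := @increment_le (fun=> 0) s t 0 (-1) s0 st (dominated_cst _ _ _ _).
move=> H1; suff : 0 - 0 <= 0 * (primitive h t - primitive h s) - -1 * (J t - J s) by lra.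
apply: H1 => r v /andP[sr _] _; exists 0; first exact: is_derive_cst.
have : 0 <= lam r * W r.
  by rewrite mulr_ge0 ?energy_ge0// ltW// lam_gt0// (le_trans s0).
lra.
Qed.

Lemma primitive_cvg : exists l : R, primitive h t @[t --> +oo] --> l.
Proof.
have [l Hl] : exists l : R, - primitive h t @[t --> +oo] --> l.
  apply: (@nonincreasing_cvg_pinfty _ _ 0 (- I)) => [s t _ st|t _].
    by rewrite lerN2; exact: primitive_nondecreasing.
  by rewrite lerN2; have /andP[] := primitive_bounded h0 ih t.
exists (- l); rewrite (_ : (fun t : R => _) = (fun t : R => - - primitive h t)).
  exact: cvgN.
by apply/funext => t; rewrite opprK.
Qed.

(** * Bounds at times when [lam'] is small *)

Section tail.
Variable T0 : R.
Hypothesis T00 : 0 <= T0.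
Hypothesis smallT0 : forall t, T0 <= t -> small t.

Let t_ge0 t : T0 <= t -> 0 <= t. Proof. exact: le_trans. Qed.

Let F_ge0 t : T0 <= t -> 0 <= F t.
Proof. by move=> Tt; exact: lyapunov_ge0 (t_ge0 Tt) (smallT0 Tt). Qed.

Let lam2W_le t : T0 <= t -> lam t ^+ 2 * W t <= 2 / K * F t.
Proof.
move=> Tt; have := lyapunov_ge (t_ge0 Tt) (smallT0 Tt).
have : 0 <= c / 8 * X t ^+ 2 by rewrite mulr_ge0 ?sqr_ge0// ltW// divr_gt0.
move=> h1 h2; rewrite -(ler_pM2l (_ : 0 < K / 2)) ?divr_gt0//.
have -> : K / 2 * (2 / K * F t) = F t by field; rewrite gt_eqF.
lra.
Qed.

Lemma dist_sqr_le_lyapunov t : T0 <= t -> X t ^+ 2 <= K * F t.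
Proof.
move=> Tt; have := lyapunov_ge (t_ge0 Tt) (smallT0 Tt).
have : 0 <= K / 2 * (lam t ^+ 2 * W t).
  by apply: mulr_ge0 => //; apply: mulr_ge0; [exact: sqr_ge0|exact: energy_ge0].
move=> h1 h2; rewrite -(ler_pM2l (_ : 0 < c / 8)) ?divr_gt0//.
have -> : c / 8 * (K * F t) = F t by rewrite /K; field; rewrite gt_eqF.
lra.
Qed.

Let lamY2_le t : (lam t * Y t) ^+ 2 <= 2 * (lam t ^+ 2 * W t).
Proof.
rewrite exprMn [leRHS]mulrCA; apply: ler_wpM2l; first exact: sqr_ge0.
by have := energy_ge t; rewrite -/(Y t); lra.
Qed.

(** With [a <= 1 + a^2], the first term is at most [1 + K F] and the second at most [K + 4 F]. *)
Let forcing_le t : T0 <= t -> X t + K * (lam t * Y t) <= (K + 5) * (1 + F t).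
Proof.
move=> Tt; have h1 := dist_sqr_le_lyapunov Tt; have h2 := lam2W_le Tt.
have h3 := lamY2_le t; have h4 := le_1Dsqr (X t); have h5 := le_1Dsqr (lam t * Y t).
have h6 : K * (lam t * Y t) <= K * (1 + 2 * (2 / K * F t)).
  by apply: ler_wpM2l; [exact: ltW|lra].
have h7 : K * (1 + 2 * (2 / K * F t)) = K + 4 * F t by field; rewrite gt_eqF.
by have := F_ge0 Tt; lra.
Qed.

(** Dividing by [1 + F] turns the forcing into [(K + 5) h] and the concavity error into at most
    [- K l2 / 2], which the derivative of [K l1 / 2] cancels. The dissipation is dropped, hence
    [B = 0]. *)
Lemma lyapunov_bounded : exists2 M, 0 <= M & forall t, T0 <= t -> F t <= M.
Proof.
pose f t := ln (1 + F t) + 2^-1 * K * l1 t.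
pose Q := f T0 + (K + 5) * I.
exists (expR Q) => [|t Tt]; first exact: expR_ge0.
have F1 s : T0 <= s -> 0 < 1 + F s by move=> /F_ge0 ?; rewrite ltr_wpDr.
have : f t - f T0 <= (K + 5) * (primitive h t - primitive h T0) - 0 * (J t - J T0).
  apply: increment_le => //.
    apply: dominatedD.
      apply: dominated_lipschitz (dominated_lyapunov t T00) => u v Tu uv _.
      by apply: ln1p_contract; apply: F_ge0 => //; exact: le_trans uv.
    by apply: dominatedM => //; [exact: dominated_cst|exact: dominated_l1].
  move=> r v /andP[Tr _] rv; have r0 := t_ge0 Tr.
  have [d Fd dle] := lyapunov_derive_le r0 (smallT0 Tr) rv.
  exists ((1 + F r)^-1 * d + 2^-1 * K * l2 r).
    apply: is_derive1D; last by apply: is_derive1Ml; exact: l1D.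
    have D1 : is_derive r (1 : R) (fun s => 1 + F s) d.
      have := is_derive1D (is_derive_cst (1 : R) r (1 : R)) Fd.
      by rewrite add0r.
    exact: (@is_derive1_comp R (@ln R) (fun s => 1 + F s) r _ _ (is_derive1_ln (F1 r Tr)) D1).
  rewrite mul0r subr0 -lerBrDr mulrC ler_pdivrMr ?F1//.
  apply: le_trans dle _.
  have h1 : h r * (X r + K * (lam r * Y r)) <= h r * ((K + 5) * (1 + F r)).
    by apply: ler_wpM2l => //; exact: forcing_le.
  have /andP[_ l20] := l2_bnd r0.
  have h2 : - l2 r * X r ^+ 2 <= - l2 r * (K * F r).
    by apply: ler_wpM2l; [rewrite oppr_ge0|exact: dist_sqr_le_lyapunov].
  have h3 : 0 <= - l2 r * K.
    by apply: mulr_ge0; [rewrite oppr_ge0|exact: ltW].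
  have h4 : 0 <= lam r * W r by rewrite mulr_ge0 ?energy_ge0// ltW// lam_gt0.
  move: h1 h2 h3 h4; lra.
rewrite mul0r subr0 => hf.
have h1 : (K + 5) * (primitive h t - primitive h T0) <= (K + 5) * I.
  by apply: ler_wpM2l; [rewrite addr_ge0// ltW|exact: primI].
have h2 : 0 <= 2^-1 * K * l1 t.
  apply: mulr_ge0; first by rewrite mulr_ge0// ltW.
  by have /andP[] := l1_bnd (t_ge0 Tt).
have h3 : ln (1 + F t) <= Q by move: hf h1 h2; rewrite /Q /f; lra.
have : 1 + F t <= expR Q by rewrite -[1 + F t]lnK ?posrE ?F1// ler_expR.
lra.
Qed.

(** * Integrability and limits once [F] is bounded *)

Section bounded_lyapunov.
Variable M : R.
Hypothesis M0 : 0 <= M.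
Hypothesis FM : forall t, T0 <= t -> F t <= M.

Let X2M t : T0 <= t -> X t ^+ 2 <= K * M.
Proof. by move=> Tt; apply: le_trans (dist_sqr_le_lyapunov Tt) _; rewrite ler_pM2l// FM. Qed.

Let KM0 : 0 <= 2^-1 * (K * M).
Proof. by rewrite mulr_ge0// mulr_ge0// ltW. Qed.

Lemma weighted_energy_bounded t : T0 <= t -> lam t ^+ 2 * W t <= 2 / K * M.
Proof.
move=> Tt; apply: le_trans (lam2W_le Tt) _; apply: ler_wpM2l; last exact: FM.
by rewrite divr_ge0// ltW.
Qed.

Let lamYM t : T0 <= t -> lam t * Y t <= 1 + 2 * (2 / K * M).
Proof.
move=> Tt; have := le_1Dsqr (lam t * Y t); have := lamY2_le t.
by have := weighted_energy_bounded Tt; lra.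
Qed.

Let B3 := (K + 5) * (1 + M).

Let B30 : 0 <= B3.
Proof. by apply: mulr_ge0; apply: addr_ge0 => //; exact: ltW. Qed.

(** Since now [X^2 <= K M], the added term offsets the concavity error without a logarithm, and the
    dissipation [lam W / 2] can be kept. *)
Let f4 t := F t + 2^-1 * (K * M) * l1 t.

Let f4_ge0 t : T0 <= t -> 0 <= f4 t.
Proof.
move=> Tt; apply: addr_ge0; first exact: F_ge0.
by apply: mulr_ge0 => //; have /andP[] := l1_bnd (t_ge0 Tt).
Qed.

Let f4_increment s t : T0 <= s -> s <= t ->
  f4 t - f4 s <= B3 * (primitive h t - primitive h s) - 2^-1 * (J t - J s).
Proof.
move=> Ts st; have s0 := t_ge0 Ts; apply: increment_le => //.
  apply: dominatedD; first exact: dominated_lyapunov.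
  by apply: dominatedM => //; [exact: dominated_cst|exact: dominated_l1].
move=> r v /andP[sr _] rv; have Tr := le_trans Ts sr; have r0 := t_ge0 Tr.
have [d Fd dle] := lyapunov_derive_le r0 (smallT0 Tr) rv.
exists (d + 2^-1 * (K * M) * l2 r).
  exact: is_derive1D Fd (is_derive1Ml (2^-1 * (K * M)) (l1D r0)).
have h1 : h r * (X r + K * (lam r * Y r)) <= h r * B3.
  apply: ler_wpM2l => //; apply: le_trans (forcing_le Tr) _.
  apply: ler_wpM2l; first by rewrite addr_ge0// ltW.
  by rewrite lerD2l FM.
have /andP[_ l20] := l2_bnd r0.
have h2 : - l2 r * X r ^+ 2 <= - l2 r * (K * M).
  by apply: ler_wpM2l; [rewrite oppr_ge0|exact: X2M].
move: dle h1 h2; lra.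
Qed.

Let JM := J T0 + 2 * (f4 T0 + B3 * I).

Let J_le t : T0 <= t -> J t <= JM.
Proof.
move=> Tt; have := f4_increment (lexx T0) Tt; have := f4_ge0 Tt.
have : B3 * (primitive h t - primitive h T0) <= B3 * I.
  by apply: ler_wpM2l => //; exact: primI.
rewrite /JM; lra.
Qed.

Lemma wenergy_primitive_cvg : exists l : R, J t @[t --> +oo] --> l.
Proof.
have [l Hl] : exists l : R, - J t @[t --> +oo] --> l.
  apply: (@nonincreasing_cvg_pinfty _ _ T0 (- JM)) => [s t Ts st|t Tt].
    by rewrite lerN2; apply: wenergy_primitive_nondecreasing => //; exact: t_ge0.
  by rewrite lerN2; exact: J_le.
exists (- l); rewrite (_ : (fun t : R => _) = (fun t : R => - - J t)).
  exact: cvgN.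
by apply/funext => t; rewrite opprK.
Qed.

Let f3 t := lam t ^+ 2 * W t.

Let f3_ge0 t : 0 <= f3 t.
Proof. by apply: mulr_ge0; [exact: sqr_ge0|exact: energy_ge0]. Qed.

Let B2 := 1 + 2 * (2 / K * M).

(** Without damping, [lam^2 W] grows by at most [2 lam' lam W <= 2 lam W] plus the forcing; as [J]
    converges, this suffices for a limit. *)
Let f3_increment s t : T0 <= s -> s <= t ->
  f3 t - f3 s <= B2 * (primitive h t - primitive h s) - (- 2) * (J t - J s).
Proof.
move=> Ts st; have s0 := t_ge0 Ts; apply: increment_le => //.
  apply: dominatedM => //; last exact: dominated_energy.
  by apply: dominatedM => //; exact: dominated_lam.
move=> r v /andP[sr _] rv; have Tr := le_trans Ts sr; have r0 := t_ge0 Tr.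
have DW := energy_derive r0 rv; case: rv => _ hv.
have Dl := lamD r0.
eexists; first exact: (is_derive1M (is_derive1M Dl Dl) DW).
have l0 := lam_gt0 r0; have /andP[l10 l11] := l1_bnd r0.
have lW : 0 <= lam r * W r by rewrite mulr_ge0 ?energy_ge0// ltW.
have -> : (l1 r * lam r + lam r * l1 r) * W r +
    lam r ^+ 2 * (ip (y r) v - c / lam r * ip (y r) (y r)) =
    2 * (l1 r * (lam r * W r)) + lam r ^+ 2 * ip (y r) v - c * (lam r * Y r ^+ 2).
  by rewrite ip_yy; field; rewrite gt_eqF.
have h1 : l1 r * (lam r * W r) <= lam r * W r by rewrite ler_piMl.
have h2 : lam r ^+ 2 * ip (y r) v <= B2 * h r.
  apply: (@le_trans _ _ ((lam r * Y r) * (lam r * `|v|))).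
    rewrite (_ : (lam r * Y r) * (lam r * `|v|) = lam r ^+ 2 * (Y r * `|v|)); last by ring.
    by apply: ler_wpM2l; [exact: sqr_ge0|exact: ip_le].
  by apply: ler_pM => //; [apply: mulr_ge0|apply: mulr_ge0|exact: lamYM];
    rewrite ?normr_ge0 ?(ltW l0).
have h3 : 0 <= c * (lam r * Y r ^+ 2).
  apply: mulr_ge0; first exact: ltW.
  by apply: mulr_ge0; [exact: ltW|exact: sqr_ge0].
move: h1 h2 h3; lra.
Qed.

(* [lam^2 W] has a limit; were it positive, [lam W] would dominate a multiple
   of [1 / (1 + t)] and could not be integrable. *)
Lemma weighted_energy_cvg0 : lam t ^+ 2 * W t @[t --> +oo] --> 0.
Proof.
have [lp Hp] := primitive_cvg; have [lJ HJ] := wenergy_primitive_cvg.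
have B20 : 0 <= B2 by rewrite addr_ge0// !mulr_ge0// ?invr_ge0 ltW.
have [lu Hu] : exists l : R, f3 t - B2 * primitive h t - 2 * J t @[t --> +oo] --> l.
  apply: (@nonincreasing_cvg_pinfty _ _ T0 (- B2 * I - 2 * JM)) => [s t Ts st|t Tt].
    have := f3_increment Ts st; lra.
  have /andP[_] := primitive_bounded h0 ih t; rewrite -/I => h1.
  have h2 : B2 * primitive h t <= B2 * I by exact: ler_wpM2l.
  have := J_le Tt; have := f3_ge0 t; lra.
pose L := lu + B2 * lp + 2 * lJ.
have fL : f3 t @[t --> +oo] --> L.
  rewrite (_ : f3 = (fun t : R => (f3 t - B2 * primitive h t - 2 * J t) +
    B2 * primitive h t + 2 * J t)); last by apply/funext => t; ring.
  apply: cvgD; last by apply: cvgM => //; exact: cvg_cst.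
  by apply: cvgD => //; apply: cvgM => //; exact: cvg_cst.
have L0 : 0 <= L.
  apply: (@closed_cvg _ _ (pinfty_nbhs R) _ f3 [set r | 0 <= r] _ _ L fL).
    exact: closed_ge.
  by exists 0; split=> // t _; exact: f3_ge0.
suff L00 : L = 0 by rewrite -L00.
apply/eqP; rewrite eq_le L0 andbT leNgt; apply/negP => Lp.
have L2 : 0 < L / 2 by rewrite divr_gt0.
move/cvgrPdist_le : fL => /(_ _ L2)[T' [_ HT']].
pose T1 := Num.max T0 (T' + 1).
have T01 : T0 <= T1 by rewrite le_max lexx.
have T10 : 0 <= T1 := t_ge0 T01.
have f3L t : T1 <= t -> L / 2 <= f3 t.
  rewrite ge_max => /andP[_ T't]; have := HT' t; rewrite /= => /(_ ltac:(lra)).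
  rewrite ler_norml => /andP[_]; lra.
have grow t : T1 <= t -> L / 2 * (ln (1 + t) - ln (1 + T1)) <= J t - J T1.
  move=> T1t.
  have D r : 0 <= r -> is_derive r (1 : R) (fun s => L / 2 * ln (1 + s)) (L / 2 * (1 + r)^-1).
    move=> r0; have r1 : 0 < 1 + r by rewrite ltr_wpDr.
    apply: is_derive1Ml.
    have D1 : is_derive r (1 : R) (fun s : R => 1 + s) (0 + 1) :=
      is_derive1D (is_derive_cst (1 : R) r (1 : R)) (is_derive_id r (1 : R)).
    have := @is_derive1_comp R (@ln R) (fun s => 1 + s) r _ _ (is_derive1_ln r1) D1.
    by rewrite add0r mulr1.
  have := @increment_le (fun s => L / 2 * ln (1 + s)) T1 t 0 (-1) T10 T1t.
  move=> H1; suff : L / 2 * ln (1 + t) - L / 2 * ln (1 + T1) <=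
    0 * (primitive h t - primitive h T1) - -1 * (J t - J T1) by lra.
  apply: H1.
    apply: (@dominated_derive _ _ _ _ _ _ (fun r => L / 2 * (1 + r)^-1) (L / 2)).
      by move=> r /andP[/(le_trans T10) r0 _]; exact: D.
    move=> r /andP[/(le_trans T10) r0 _].
    have r1 : 1 <= 1 + r by rewrite lerDl.
    rewrite ger0_norm; last by rewrite mulr_ge0 ?invr_ge0 ?(ltW L2)// (le_trans ler01).
    by rewrite ler_piMr ?(ltW L2)// invf_le1// (lt_le_trans ltr01).
  move=> r v /andP[T1r _] _; have r0 := le_trans T10 T1r.
  eexists; first exact: D.
  have r1 : 0 < 1 + r by rewrite ltr_wpDr.
  suff : L / 2 * (1 + r)^-1 <= lam r * W r by lra.
  rewrite ler_pdivrMr//; apply: le_trans (f3L r T1r) _.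
  have /andP[_ lr] := lam_bnd r0; rewrite /f3 expr2 -mulrA mulrC.
  by apply: ler_wpM2l => //; rewrite mulr_ge0 ?energy_ge0// ltW// lam_gt0.
pose D := JM - J T1.
have D0 : 0 <= D by rewrite subr_ge0 J_le.
(* At time [expR N - 1] the logarithmic lower bound on the gain of [J] since [T1] reaches [D + 1],
   whereas [J] can gain at most [D]. *)
pose N := ln (1 + T1) + (D + 1) / (L / 2).
have T11 : 0 < 1 + T1 by rewrite ltr_wpDr.
have NT : T1 <= expR N - 1.
  rewrite lerBrDl -[leLHS]lnK ?posrE// ler_expR lerDl divr_ge0 ?(ltW L2)//.
  by rewrite addr_ge0.
have := grow _ NT; rewrite (addrC 1 (expR N - 1)) subrK expRK.
have -> : N - ln (1 + T1) = (D + 1) / (L / 2) by rewrite /N addrAC subrr add0r.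
rewrite mulrC divfK ?gt_eqF// => h1.
have := J_le (le_trans T01 NT); move: h1; rewrite /D; lra.
Qed.

(** [F] converges, being a monotone bounded-below function plus convergent terms. All its terms
    except [c |x - z|^2 / 2] vanish in the limit, the cross term by [lam |y| <= sqrt (2 lam^2 W)];
    solving for [|x - z|^2] gives the factor [2 / c]. *)
Lemma dist_sqr_cvg : exists l : R, `|x t - z| ^+ 2 @[t --> +oo] --> l.
Proof.
have [lp Hp] := primitive_cvg.
have [lu Hu] : exists l : R, f4 t - B3 * primitive h t @[t --> +oo] --> l.
  apply: (@nonincreasing_cvg_pinfty _ _ T0 (- B3 * I)) => [s t Ts st|t Tt].
    have := f4_increment Ts st.
    have := wenergy_primitive_nondecreasing (t_ge0 Ts) st; lra.
  have /andP[_] := primitive_bounded h0 ih t; rewrite -/I => h1.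
  have h2 : B3 * primitive h t <= B3 * I by exact: ler_wpM2l.
  have := f4_ge0 Tt; lra.
have lamP0 : lam t * ip (y t) (x t - z) @[t --> +oo] --> 0.
  apply: (@squeeze0_pinfty _ _ (fun t => Num.sqrt (2 * f3 t) * Num.sqrt (K * M)) T0).
    move=> t Tt; rewrite normrM gtr0_norm ?lam_gt0 ?t_ge0//.
    apply: (@le_trans _ _ ((lam t * Y t) * X t)).
      rewrite -mulrA; apply: ler_wpM2l; first exact: ltW (lam_gt0 (t_ge0 Tt)).
      exact: ip_CauchySchwarz.
    have lY0 : 0 <= lam t * Y t.
      by apply: mulr_ge0; [exact: ltW (lam_gt0 (t_ge0 Tt))|exact: normr_ge0].
    apply: ler_pM => //; first exact: normr_ge0.
      by rewrite -[leLHS](ger0_norm lY0) -sqrtr_sqr ler_wsqrtr// lamY2_le.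
    by rewrite -[leLHS](@ger0_norm _ (X t)) ?normr_ge0// -sqrtr_sqr ler_wsqrtr// X2M.
  rewrite -(mul0r (Num.sqrt (K * M))); apply: cvgM; last exact: cvg_cst.
  rewrite -[X in _ --> X](@sqrtr0 R).
  apply: (@cvg_comp _ _ _ (fun t => 2 * f3 t) (@Num.sqrt R) _ (nbhs (0 : R))); last first.
    exact: sqrt_continuous.
  rewrite -(mulr0 2); apply: cvgM; first exact: cvg_cst.
  exact: weighted_energy_cvg0.
have l1X0 : l1 t * X t ^+ 2 @[t --> +oo] --> 0.
  apply: (@squeeze0_pinfty _ _ (fun t => l1 t * (K * M)) T0).
    move=> t Tt; have /andP[l10 _] := l1_bnd (t_ge0 Tt).
    rewrite ger0_norm; last by rewrite mulr_ge0 ?sqr_ge0.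
    by apply: ler_wpM2l => //; exact: X2M.
  by rewrite -(mul0r (K * M)); apply: cvgM => //; exact: cvg_cst.
pose lF := lu + B3 * lp - 2^-1 * (K * M) * 0.
have FlF : F t @[t --> +oo] --> lF.
  rewrite (_ : F = (fun t : R => (f4 t - B3 * primitive h t) + B3 * primitive h t
    - 2^-1 * (K * M) * l1 t)); last by apply/funext => t; rewrite /f4; ring.
  apply: cvgB; last by apply: cvgM => //; exact: cvg_cst.
  by apply: cvgD => //; apply: cvgM => //; exact: cvg_cst.
exists (2 / c * (lF - K * 0 - 0 + 2^-1 * 0)).
rewrite (_ : (fun t : R => _) = (fun t : R => 2 / c * (F t - K * f3 t -
    lam t * ip (y t) (x t - z) + 2^-1 * (l1 t * X t ^+ 2)))); last first.
  apply/funext => t; rewrite /lyapunov /f3 ip_xz -/(X t); field.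
  by rewrite gt_eqF.
apply: cvgM; first exact: cvg_cst.
apply: cvgD; last by apply: cvgM => //; exact: cvg_cst.
apply: cvgB => //; apply: cvgB => //.
apply: cvgM; [exact: cvg_cst|exact: weighted_energy_cvg0].
Qed.

End bounded_lyapunov.

End tail.

Lemma trajectory_asymptotics :
  [/\ exists l : R, `|x t - z| ^+ 2 @[t --> +oo] --> l,
      exists l : R, J t @[t --> +oo] --> l,
      lam t ^+ 2 * W t @[t --> +oo] --> 0,
      exists C T, forall t, T <= t -> lam t ^+ 2 * W t <= C &
      exists C T, forall t, T <= t -> `|x t - z| <= C].
Proof.
have [T T0 sT] := smallP; have [M M0 FM] := lyapunov_bounded T0 sT.
split.
- exact: dist_sqr_cvg FM.
- exact: wenergy_primitive_cvg FM.
- exact: weighted_energy_cvg0 FM.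
- by exists (2 / K * M), T => t; exact: weighted_energy_bounded.
- exists (1 + K * M), T => t Tt; apply: le_trans (le_1Dsqr _) _.
  rewrite lerD2l; apply: le_trans (dist_sqr_le_lyapunov T0 sT Tt) _.
  by apply: ler_wpM2l; [exact: ltW|exact: FM].
Qed.

End lyapunov.

End Trajectory.

(** * The weight and the conclusion *)

Section Weight.
Context {R : realType}.
Variable alpha : R.
Hypothesis alpha_ge0 : 0 <= alpha.
Hypothesis alpha_lt1 : alpha < 1.
Implicit Types (a t : R).

Lemma is_derive_powR1D a t : 0 <= t ->
  is_derive t (1 : R) (fun s => (1 + s) `^ a) (a * (1 + t) `^ (a - 1)).
Proof.
move=> t0; have t1 : 0 < 1 + t by rewrite ltr_wpDr.
have D1 := is_derive1D (is_derive_cst (1 : R) t (1 : R)) (is_derive_id t (1 : R)).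
have := @is_derive1_comp R (fun u => u `^ a) (fun s => 1 + s) t _ _
  (is_derive1_powR a t1) D1.
by rewrite add0r mulr1.
Qed.

Lemma powR1D_bounds t : 0 <= t -> 1 <= (1 + t) `^ alpha <= 1 + t.
Proof.
move=> t0; have t1 : 1 <= 1 + t by rewrite lerDl.
rewrite -[X in X <= _ <= _](powRr0 (1 + t)) -[X in _ <= _ <= X]powRr1 ?addr_ge0//.
by rewrite !ler_powR// ltW.
Qed.

Let powR1D_le1 a t : a <= 0 -> 0 <= t -> 0 <= (1 + t) `^ a <= 1.
Proof.
move=> a0 t0; rewrite powR_ge0/= -[leRHS](powRr0 (1 + t)).
by rewrite ler_powR// lerDl.
Qed.

Lemma powR1D_derive_bounds t : 0 <= t -> 0 <= alpha * (1 + t) `^ (alpha - 1) <= 1.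
Proof.
move=> t0; have /andP[p0 p1] : 0 <= (1 + t) `^ (alpha - 1) <= 1.
  by apply: powR1D_le1 => //; rewrite subr_le0 ltW.
by rewrite mulr_ge0//= mulr_ile1// ltW.
Qed.

Lemma powR1D_derive2_bounds t : 0 <= t ->
  -1 <= alpha * ((alpha - 1) * (1 + t) `^ (alpha - 1 - 1)) <= 0.
Proof.
move=> t0; have /andP[p0 p1] : 0 <= (1 + t) `^ (alpha - 1 - 1) <= 1.
  by apply: powR1D_le1 => //; rewrite -addrA -opprD subr_le0 (le_trans (ltW alpha_lt1))// lerDl.
set p := (1 + t) `^ _ in p0 p1 *.
have q0 : 0 <= (1 - alpha) * p by rewrite mulr_ge0// subr_ge0 ltW.
have q1 : (1 - alpha) * p <= 1 by apply: mulr_ile1; rewrite ?subr_ge0 ?(ltW alpha_lt1)// gerBl.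
have r0 : 0 <= alpha * ((1 - alpha) * p) by rewrite mulr_ge0.
have r1 : alpha * ((1 - alpha) * p) <= 1 by rewrite mulr_ile1// ltW.
lra.
Qed.

Lemma powR1D_derive_cvg0 : alpha * (1 + t) `^ (alpha - 1) @[t --> +oo] --> 0.
Proof.
have b0 : 0 < 1 - alpha by rewrite subr_gt0.
apply/cvgrPdist_le => e e0.
(* The time at which [U^(1 - alpha) = 1 / e]; the factor [alpha <= 1] is discarded. *)
pose U := e^-1 `^ (1 - alpha)^-1.
exists (Num.max 0 U); split; first exact: num_real.
move=> t; rewrite gt_max => /andP[/ltW t0 Ut] /=.
have /andP[d0 _] := powR1D_derive_bounds t0.
rewrite sub0r normrN ger0_norm//.
apply: (@le_trans _ _ ((1 + t) `^ (alpha - 1))).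
  by rewrite ler_piMl ?powR_ge0// ltW.
rewrite -[alpha - 1]opprB powRN -[leRHS]invrK.
have Ue : U `^ (1 - alpha) = e^-1.
  by rewrite -powRrM mulVf ?gt_eqF// powRr1// invr_ge0 ltW.
rewrite lef_pV2 ?posrE ?invr_gt0 ?powR_gt0 ?ltr_wpDr//.
rewrite -Ue; apply: ge0_ler_powR; rewrite ?(ltW b0) ?nnegrE ?powR_ge0 ?addr_ge0//.
by rewrite (le_trans (ltW Ut))// lerDr.
Qed.

End Weight.

Theorem theorem1 (R : realType) (H : completeNormedModType R)
  (ip : H -> H -> R) (Phi : H -> R) (gradPhi : H -> H) (Phistar : R)
  (c alpha : R) (g x : R -> H) :
  is_inner_product ip ->
  convex_fun Phi ->
  is_gradient ip Phi gradPhi ->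
  continuous gradPhi ->
  (exists v : H, Phi v = Phistar) ->
  (forall y : H, Phistar <= Phi y) ->
  0 < c -> 0 <= alpha < 1 ->
  L1_pos g ->
  (* x in W^{2,1}_loc: x is differentiable on [0,+oo) and its derivative
     is absolutely continuous on every compact [0, T] *)
  (forall t, 0 <= t -> derivable x t 1) ->
  (forall T, 0 <= T -> abs_continuous_on 0 T ('D_1 x)) ->
  (* the equation, for almost every t >= 0 *)
  {ae @lebesgue_measure R, forall t, 0 <= t ->
      derivable ('D_1 x) t 1 /\
      'D_1 ('D_1 x) t + (c / (1 + t) `^ alpha) *: 'D_1 x t + gradPhi (x t)
        = g t} ->
  (\int[@lebesgue_measure R]_(t in `[0%R, +oo[%classic)
      ((1 + t) `^ alpha * `|g t|)%:E < +oo)%E ->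
  let W := fun t => 2^-1 * `|'D_1 x t| ^+ 2 + Phi (x t) - Phistar in
  (exists xstar : H, (forall y : H, Phi xstar <= Phi y) /\
     forall y : H, ip (x t) y @[t --> +oo] --> ip xstar y) /\
  (exists C M : R, forall t, M <= t -> `|W t| <= C / t `^ (2 * alpha)) /\
  (\int[@lebesgue_measure R]_(t in `[0%R, +oo[%classic)
      ((1 + t) `^ alpha * W t)%:E < +oo)%E.
Proof.
move=> hip hconv hgrad contG [z0 hz0] hmin c0 /andP[a0 a1] [mg _] dx acy eqn ig W.
set y := 'D_1 x in acy eqn W *.
pose mu := @lebesgue_measure R.
pose lam t : R := (1 + t) `^ alpha.
pose l1 t : R := alpha * (1 + t) `^ (alpha - 1).
pose l2 t : R := alpha * ((alpha - 1) * (1 + t) `^ (alpha - 1 - 1)).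
have lamD (t : R) : 0 <= t -> is_derive t (1 : R) lam (l1 t) by exact: is_derive_powR1D.
have l1D (t : R) : 0 <= t -> is_derive t (1 : R) l1 (l2 t).
  by move=> t0; apply: is_derive1Ml; exact: is_derive_powR1D.
have lam_bnd (t : R) : 0 <= t -> 1 <= lam t <= 1 + t by exact: powR1D_bounds.
have l1_bnd (t : R) : 0 <= t -> 0 <= l1 t <= 1 by exact: powR1D_derive_bounds.
have l2_bnd (t : R) : 0 <= t -> -1 <= l2 t <= 0 by exact: powR1D_derive2_bounds.
have l1_cvg0 : l1 t @[t --> +oo] --> 0 by exact: powR1D_derive_cvg0.
have xD (t : R) : 0 <= t -> is_derive t (1 : R) x (y t).
  by move=> t0; apply: derivableP; exact: dx.
(* Extension by zero makes the weighted forcing integrable on the whole line, as its primitive from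
   [-oo] requires. *)
pose h := (fun t : R => lam t * `|g t|) \_ `[0%R, +oo[.
have h0 (t : R) : 0 <= h t.
  by rewrite /h patchE; case: ifP => // _; rewrite mulr_ge0// powR_ge0.
have ih : mu.-integrable setT (EFin \o h).
  rewrite -restrict_EFin; apply/integrable_restrict => //=.
  rewrite setTI; apply/integrableP; split.
    apply/measurable_EFinP; apply: measurable_funM; last first.
      by apply: strongly_measurable_norm.
    apply: measurable_funTS.
    apply: (measurableT_comp (measurable_powR alpha)).
    by apply: measurable_funD => //; exact: measurable_cst.
  apply: le_lt_trans ig; rewrite le_eqVlt; apply/orP; left; apply/eqP.
  apply: eq_integral => t _ /=.
  by rewrite ger0_norm// mulr_ge0// powR_ge0.
have eqn' : {ae mu, forall t : R, 0 <= t -> exists v, solves_at gradPhi c lam x y h t v}.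
  move: eqn; apply: filterS; first exact: (ae_filter_ringOfSetsType mu).
  move=> t Ht t0; have [dy Ey] := Ht t0; exists (g t); split.
    rewrite (_ : _ - _ - _ = 'D_1 y t); first exact: derivableP.
    by rewrite -Ey addrAC !addrK.
  by rewrite /h patchE mem_set//= in_itv/= t0.
have asym z (hz : Phi z = Phistar) := trajectory_asymptotics hip hconv hgrad contG hmin
  c0 lamD l1D lam_bnd l1_bnd l2_bnd l1_cvg0 xD acy h0 ih eqn' hz.
have [_ [lJ HJ] lW0 [C [T lWC]] [C' [T' xC]]] := asym _ hz0.
have W0 t : 0 <= W t := energy_ge0 hmin x y t.
split; last split.
- have [|||p [Sp xp]] := @Opial _ _ ip hip x T' (C' + `|z0|) _ [set z | Phi z = Phistar].
  + move=> t Tt; rewrite -[x t](subrK z0).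
    by apply: le_trans (ler_normD _ _) _; rewrite lerD2r xC.
  + by move=> z /asym[].
  + move=> A p _ ap; apply/eqP; rewrite eq_le hmin andbT.
    (* Since [lam >= 1], the gap [Phi (x t) - Phistar] is at most [W <= lam^2 W], which tends to
       0. *)
    apply: (asymptotic_point_sublevel hip hconv hgrad _ ap) => e e0.
    move/cvgrPdist_le : lW0 => /(_ e e0)[N [_ HN]].
    exists (Num.max 0 (N + 1)) => t; rewrite ge_max => /andP[t0 Nt].
    have := HN t; rewrite /= => /(_ ltac:(lra)).
    rewrite sub0r normrN => /(le_trans (ler_norm _)) h1.
    have /andP[lam1 _] := lam_bnd t t0.
    have h2 : W t <= lam t ^+ 2 * W t by rewrite ler_peMl// exprn_ege1.
    have h3 := energy_ge_gap Phi Phistar x y t.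
    by rewrite -lerBlDl; apply: le_trans h3 (le_trans h2 h1).
  + by exists p; split => // u; rewrite Sp.
- exists C, (Num.max T 1) => t; rewrite ge_max => /andP[Tt t1].
  have t0 : 0 < t := lt_le_trans ltr01 t1.
  rewrite ger0_norm// ler_pdivlMr ?powR_gt0// mulrC.
  apply: le_trans (lWC t Tt); apply: ler_wpM2r => //.
  rewrite mulrC powRrM powR_mulrn ?powR_ge0//.
  rewrite ler_pXn2r ?nnegrE ?powR_ge0//; apply: ge0_ler_powR => //.
  + by rewrite nnegrE ltW.
  + by rewrite nnegrE addr_ge0// ltW.
  + by rewrite lerDr.
- have JD (t : R) : 0 <= t ->
      is_derive t (1 : R) (wenergy_primitive Phi Phistar lam x y) (lam t * W t).
    by move=> t0; exact: (wenergy_primitive_derive Phistar hip hgrad lamD xD acy t0).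
  (* On the half-line the integrand agrees with the globally continuous [wenergy]; its primitive has
     the finite limit [lJ], so the integral is finite. *)
  rewrite [ltLHS](_ : _ =
      (\int[mu]_(t in `[0%R, +oo[) (wenergy Phi Phistar lam x y t)%:E)%E); last first.
    apply: eq_integral => t; rewrite inE/= in_itv/= andbT => t0.
    by rewrite /wenergy posr_id.
  rewrite (ge0_continuous_FTC2y _ _ HJ) ?ltry//.
  + by move=> t _; apply: mulr_ge0; [exact: powR_ge0|exact: energy_ge0].
  + apply: continuous_subspaceT.
    exact: (wenergy_continuous hip hgrad lamD xD acy).
  + by move=> t /ltW /JD[].
  + by apply: cvg_at_right_filter; exact: is_derive1_continuous (JD 0 (lexx 0)).
  + move=> t; rewrite in_itv/= andbT => /ltW t0.
    by rewrite derive1E /wenergy posr_id//; case: (JD t t0).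
Qed.
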